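(* Let $\Xi\subset\mathbb{R}^K$ be equipped with a metric $d$, let $1\le p<\infty$, $R_0>0$, $m_0\in\mathbb{R}^K$, $\Sigma_0\succeq 0$ a $K\times K$ matrix, and let $\nu\in\mathcal{P}(\Xi)$ be a nominal distribution. Let $\Psi:\Xi\to\mathbb{R}$ be upper semi-continuous and assume that, for some $\zeta_0\in\Xi$, $$\kappa:=\limsup_{d(\xi,\zeta_0)\to\infty}\frac{\max\big(\Psi(\xi)-\Psi(\zeta_0),0\big)}{d^p(\xi,\zeta_0)}<\infty .$$ Let $$\mathfrak{M}_1:=\Big\{\mu\in\mathcal{P}(\Xi):\ W_p(\mu,\nu)\le R_0,\ \ \mathbb{E}_\mu\big[(\xi-m_0)(\xi-m_0)^\top\big]\preceq\Sigma_0\Big\}.$$ Assume that $\mathbb{E}_\nu[(\xi-m_0)(\xi-m_0)^\top]\prec\Sigma_0$. Then strong duality holds, with the dual minimum attained: $$\sup_{\mu\in\mathfrak{M}_1}\mathbb{E}_\mu[\Psi(\xi)]=\min_{\lambda\ge 0,\ \Lambda\succeq 0}\Big\{\lambda R_0^p+\langle\Lambda,\Sigma_0\rangle+\int_\Xi\sup_{\xi\in\Xi}\big[\Psi(\xi)-\lambda d^p(\xi,\zeta)-(\xi-m_0)^\top\Lambda(\xi-m_0)\big]\,\nu(d\zeta)\Big\}.$$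
   Context: $\mathcal{P}(\Xi)$ is the set of all Borel probability distributions on $\Xi$. $W_p$ is the Wasserstein metric of order $p$ associated with the metric $d$ on $\Xi$: $W_p^p(\mu,\nu)=\min\{\int_{\Xi^2}d^p(\xi,\zeta)\,\gamma(d\xi,d\zeta):\ \gamma\in\mathcal{P}(\Xi^2)\text{ has marginals }\mu,\nu\}$. For symmetric matrices, $A\preceq B$ (resp. $A\prec B$) means that $B-A$ is positive semidefinite (resp. positive definite), $\Lambda\succeq0$ ranges over symmetric positive semidefinite $K\times K$ matrices, and $\langle\Lambda,\Sigma\rangle=\mathrm{tr}(\Lambda^\top\Sigma)$. The integrand of the dual is understood to be measurable with respect to the completion of the Borel $\sigma$-algebra of $\Xi$ under $\nu$. *)

(* Defs.v *)
From HB Require Import structures.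
From mathcomp Require Import all_boot all_order all_algebra.
From mathcomp Require Import all_classical all_reals all_analysis.

Set Implicit Arguments.
Unset Strict Implicit.
Unset Printing Implicit Defensive.

Import Order.TTheory GRing.Theory Num.Theory.
Import numFieldNormedType.Exports.

Local Open Scope classical_set_scope.
Local Open Scope ring_scope.

Record is_metric (R : realType) (T : Type) (d : T -> T -> R) : Prop := IsMetric {
  dist_xx : forall x, d x x = 0;
  dist_eq0 : forall x y, d x y = 0 -> x = y;
  dist_sym : forall x y, d x y = d y x;
  dist_tri : forall y x z, d x z <= d x y + d y z }.

(* The set Xi with the topology of the metric d, which need not be that of
   R^K. The point x0 is only recorded because measurable types are pointed. *)
Definition metric_sub (R : realType) (K : nat) (Xi : set 'cV[R]_K)
  (d : Xi -> Xi -> R) (hd : is_metric d) (x0 : Xi) : Type := set_type Xi.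

Section metric_sub_instances.
Context (R : realType) (K : nat) (Xi : set 'cV[R]_K) (d : Xi -> Xi -> R)
  (hd : is_metric d) (x0 : Xi).

HB.instance Definition _ := Choice.copy (metric_sub hd x0) (set_type Xi).
HB.instance Definition _ := isPointed.Build (metric_sub hd x0) x0.
HB.instance Definition _ := @isMetric.Build R (metric_sub hd x0) d
  (dist_xx hd) (dist_eq0 hd) (dist_sym hd) (dist_tri hd).

End metric_sub_instances.

Definition pos_of (R : realType) (K : nat) (Xi : set 'cV[R]_K)
  (d : Xi -> Xi -> R) (hd : is_metric d) (x0 : Xi)
  (x : metric_sub hd x0) : 'cV[R]_K := set_val (x : Xi).

Notation borel T := (g_sigma_algebraType (@open T%type)).

Definition upper_semicontinuous (R : realType) (T : topologicalType)
  (f : T -> R) := forall x a, f x < a -> \forall y \near x, f y < a.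

Definition psdmx (R : realType) (K : nat) (A : 'M[R]_K) :=
  A^T = A /\ forall u : 'cV[R]_K, 0 <= (u^T *m A *m u) 0 0.

Definition pdmx (R : realType) (K : nat) (A : 'M[R]_K) :=
  A^T = A /\ forall u : 'cV[R]_K, u != 0 -> 0 < (u^T *m A *m u) 0 0.

Definition loewner_le (R : realType) (K : nat) (A B : 'M[R]_K) := psdmx (B - A).

Definition loewner_lt (R : realType) (K : nat) (A B : 'M[R]_K) := pdmx (B - A).

(* Integral of f^+ minus integral of f^-, with +oo - +oo = +oo (the dual
   addition), whereas \int[mu]_x f x uses +oo - +oo = -oo. The two agree as
   soon as one of the two parts has a finite integral. *)
Definition dintegral (dsp : measure_display) (T : measurableType dsp)
    (R : realType) (mu : {measure set T -> \bar R}) (f : T -> \bar R) : \bar R :=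
  ((\int[mu]_x (f^\+)%E x)%E - (\int[mu]_x (f^\-)%E x)%E)%dE.

Section problem.
Context (R : realType) (K : nat) (Xi : set 'cV[R]_K) (d : Xi -> Xi -> R)
  (hd : is_metric d) (x0 : Xi).
Local Notation X := (metric_sub hd x0).
Implicit Types mu nu : probability (borel X) R.

Definition coupling mu nu (gamma : probability (borel (X * X)) R) : Prop :=
  forall A : set (borel X), measurable A ->
    gamma (fst @^-1` A) = mu A /\ gamma (snd @^-1` A) = nu A.

Definition wasserstein (p : R) mu nu : \bar R :=
  (poweR (ereal_inf
    [set (\int[gamma]_z ((d z.1 z.2) `^ p)%:E)%E | gamma in coupling mu nu])
   p^-1)%E.

Definition outer (m0 : 'cV[R]_K) (x : X) : 'M[R]_K :=
  (pos_of x - m0) *m (pos_of x - m0)^T.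

Definition has_second_moment (m0 : 'cV[R]_K) mu : Prop :=
  forall i j, mu.-integrable setT (fun x => (outer m0 x i j)%:E).

Definition second_moment (m0 : 'cV[R]_K) mu : 'M[R]_K :=
  \matrix_(i, j) (\int[mu]_x (outer m0 x i j))%R.

Definition ambiguity_set (p R0 : R) (m0 : 'cV[R]_K) (Sigma0 : 'M[R]_K) nu :
    set (probability (borel X) R) :=
  [set mu | [/\ (wasserstein p mu nu <= R0%:E)%E, has_second_moment m0 mu &
              loewner_le (second_moment m0 mu) Sigma0]].

(* The limsup is -oo when (Xi, d) is bounded. *)
Definition growth_rate (p : R) (Psi : X -> R) (zeta0 : X) : \bar R :=
  limf_esup
    (fun xi : X => (Num.max (Psi xi - Psi zeta0) 0 / d xi zeta0 `^ p)%:E)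
    (filter_from [set: R] (fun r => [set xi : X | r < d xi zeta0])).

Definition primal_value (p R0 : R) (m0 : 'cV[R]_K) (Sigma0 : 'M[R]_K) nu
    (Psi : X -> R) : \bar R :=
  ereal_sup [set dintegral mu (fun xi => (Psi xi)%:E) |
              mu in ambiguity_set p R0 m0 Sigma0 nu].

(* As a supremum of functions of zeta that are continuous for d, this is lower
   semicontinuous, hence Borel measurable. *)
Definition dual_integrand (p : R) (m0 : 'cV[R]_K) (Psi : X -> R)
    (lambda : R) (Lambda : 'M[R]_K) (zeta : X) : \bar R :=
  ereal_sup (range (fun xi : X =>
    (Psi xi - lambda * d xi zeta `^ p
     - ((pos_of xi - m0)^T *m Lambda *m (pos_of xi - m0)) 0 0)%:E)).

Definition dual_objective (p R0 : R) (m0 : 'cV[R]_K) (Sigma0 : 'M[R]_K) nu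
    (Psi : X -> R) (lambda : R) (Lambda : 'M[R]_K) : \bar R :=
  ((lambda * R0 `^ p + \tr (Lambda^T *m Sigma0))%:E
   + dintegral nu (dual_integrand p m0 Psi lambda Lambda))%E.

End problem.

(* Main.v *)
(* A plan is a measure on Xi x Xi with second marginal nu, and the primal
   problem maximises a linear functional of plans under a scalar and a matrix
   inequality. Weak duality is obtained by integrating
   Psi(xi) <= phi(zeta) + lambda d^p(xi, zeta) + (xi - m0)^T Lambda (xi - m0).
   Conversely, Lagrange multipliers exist as soon as a plan with a finite gain
   satisfies both constraints strictly, and a measurable near-maximiser
   zeta |-> T(zeta) exchanges the supremum over plans with the integral of the
   pointwise supremum phi. The diagonal plan is strictly feasible, but its gain
   may be -oo; since Psi is finite, rerouting only the points of {Psi < -n}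
   along some plan with a gain above -oo restores a strictly feasible plan with
   a finite gain. If there is no such plan, the primal value is -oo, and large
   enough multipliers make the dual objective -oo as well.
   The metric d need not be separable: the selection T comes from a
   well-ordering of Xi. *)

(* Attainment of the dual minimum needs no compactness: the multipliers are constructed outright.
   Perturbations of the constraints range over the finite-dimensional space of pairs (scalar,
   matrix), so it suffices to make a sublinear functional linear along finitely many basis vectors,
   one vector at a time. The obstacle in the exchange of supremum and integral is that a
   near-maximiser T may have infinite cost, second moment or gain, and then the multiplier
   inequality says nothing about its graph. A plan of finite weight therefore has to be at hand from
   the start, to be kept wherever T is expensive. If no such plan exists, this very failure shows
   that the dual value is -oo. Couplings live on the Borel sets of Xi x Xi, which for a
   non-separable d need not a priori be generated by measurable rectangles. Hence a selection T is
   measurable in the sense that the graph map from z to (T z, z) is Borel into Xi x Xi, and only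
   then does its graph carry a plan. *)
Require Import Defs.
From HB Require Import structures.
From mathcomp Require Import all_boot all_order all_algebra.
From mathcomp Require Import all_classical all_reals all_analysis.
From mathcomp Require Import measurable_realfun.
From mathcomp Require Import ring lra.
Import Order.TTheory GRing.Theory Num.Theory.
Import numFieldNormedType.Exports.
Local Open Scope classical_set_scope.
Local Open Scope ring_scope.
Set Implicit Arguments.
Unset Strict Implicit.
Unset Printing Implicit Defensive.

(** * Sublinear functionals *)

Definition sublinear (R : realType) (V : lmodType R) (p : V -> R) :=
  (forall x y, p (x + y) <= p x + p y) /\
  (forall t x, 0 < t -> p (t *: x) = t * p x).

Section sublinear.
Context (R : realType) (V : lmodType R).
Implicit Types (p q : V -> R) (e x : V).

Lemma sublinear0 p : sublinear p -> p 0 = 0.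
Proof.
move=> [_ ph]; have := ph 2 0 ltac:(by []); rewrite scaler0 => h.
by apply/eqP; rewrite -subr_eq0; apply/eqP; lra.
Qed.

Lemma sublinear_ge_opp p x : sublinear p -> - p (- x) <= p x.
Proof.
move=> sp; have := sp.1 x (- x); rewrite subrr (sublinear0 sp) => h; lra.
Qed.

(** With s = 1/t, the quantity p (x + t e) - t p e is the quotient (p (e + s x) - p e) / s, so [q]
    is the directional derivative of [p] at [e]. It inherits sublinearity, and [p] is linear along
    the ray of [e], which makes [q] odd there. *)
Lemma sublinear_linearize p e : sublinear p ->
  exists q, [/\ sublinear q, forall x, q x <= p x & q (- e) = - q e].
Proof.
move=> sp; have [psub ph] := sp; have p0 := sublinear0 sp.
pose E x := [set p (x + t *: e) - t * p e | t in [set t : R | 0 <= t]].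
have pz t x : 0 <= t -> p (t *: x) = t * p x.
  by rewrite le_eqVlt => /orP[/eqP<-|/ph//]; rewrite scale0r p0 mul0r.
have lbE x : lbound (E x) (- p (- x)).
  move=> _ [t t0 <-]; have := psub (- x) (x + t *: e).
  rewrite addKr pz// => h; lra.
have hE x : has_lbound (E x) by exists (- p (- x)).
have E0 x : E x !=set0 by exists (p (x + 0 *: e) - 0 * p e), 0 => /=.
pose q x := inf (E x).
have qle x t : 0 <= t -> q x <= p (x + t *: e) - t * p e.
  by move=> t0; apply: ge_inf => //; exists t.
have qp x : q x <= p x.
  by apply: le_trans (qle x 0 (lexx _)) _; rewrite scale0r mul0r addr0 subr0.
have sq : sublinear q.
  split=> [x y|t x t0].
    apply/ler_addgt0Pl => eps eps0.
    have [_ [s s0 <-] hs] := inf_adherent (divr_gt0 eps0 (ltr0n _ 2)) (conj (E0 x) (hE x)).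
    have [_ [t t0 <-] ht] := inf_adherent (divr_gt0 eps0 (ltr0n _ 2)) (conj (E0 y) (hE y)).
    have := qle (x + y) (s + t) (addr_ge0 s0 t0).
    have := psub (x + s *: e) (y + t *: e).
    rewrite addrACA -scalerDl -/(q x) -/(q y) in hs ht *; lra.
  have le_h (a : R) y : 0 < a -> q (a *: y) <= a * q y.
    move=> a0; rewrite -ler_pdivrMl//; apply: lb_le_inf => // _ [s s0 <-].
    rewrite ler_pdivrMl//.
    apply: le_trans (qle (a *: y) (a * s) (mulr_ge0 (ltW a0) s0)) _.
    by rewrite -scalerA -scalerDr ph// mulrBr mulrA.
  apply/eqP; rewrite eq_le le_h//=.
  have := @le_h t^-1 (t *: x); rewrite invr_gt0 scalerA mulVf ?gt_eqF// scale1r.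
  by move=> /(_ t0); rewrite ler_pdivlMl// mulrC.
exists q; split => //.
have h1 : q (- e) <= - p e.
  (* At t = 1 the argument - e + t e vanishes. *)
  have := qle (- e) 1 ler01; rewrite scale1r addNr p0 mul1r; lra.
have := sublinear_ge_opp e sq; have := qp e; lra.
Qed.

(** Oddness gained at f survives later steps: if r <= q are sublinear and q is odd at f, then r f <=
    q f = - q (- f) <= - r (- f) <= r f. *)
Lemma sublinear_linearize_seq p (s : seq V) : sublinear p ->
  exists q, [/\ sublinear q, forall x, q x <= p x &
                forall e, e \in s -> q (- e) = - q e].
Proof.
move=> sp; elim: s => [|e s [q [sq qp qs]]]; first by exists p.
have [r [sr rq re]] := sublinear_linearize e sq.
exists r; split => // [x|f]; first exact: le_trans (rq x) (qp x).
rewrite inE => /orP[/eqP->//|fs].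
have := sublinear_ge_opp f sr; have := qs f fs; have := rq f; have := rq (- f).
by lra.
Qed.

(** The points of oddness form a subspace on which a sublinear functional is linear; oddness at a
    basis thus gives linearity everywhere. *)
Lemma sublinear_oddD p x y : sublinear p -> p (- x) = - p x ->
  p (- y) = - p y -> p (x + y) = p x + p y /\ p (- (x + y)) = - p (x + y).
Proof.
move=> sp px py; have := sublinear_ge_opp (x + y) sp.
have := sp.1 x y; have := sp.1 (- x) (- y); rewrite opprD px py => h1 h2 h3.
split; apply/eqP; rewrite eq_le; apply/andP; split; lra.
Qed.

Lemma sublinear_oddZ p a x : sublinear p -> p (- x) = - p x ->
  p (a *: x) = a * p x /\ p (- (a *: x)) = - p (a *: x).
Proof.
move=> sp px.
have h b : p (b *: x) = b * p x.
  have [b0|b0|->] := ltgtP b 0; last by rewrite scale0r (sublinear0 sp) mul0r.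
    by rewrite -[b in LHS]opprK scaleNr -scalerN sp.2 ?oppr_gt0// px mulrNN.
  by rewrite sp.2.
by rewrite h -scaleNr h mulNr.
Qed.

Lemma sublinear_odd_sum p (I : Type) (s : seq I) (a : I -> R) (e : I -> V) :
  sublinear p -> (forall i, p (- e i) = - p (e i)) ->
  p (\sum_(i <- s) a i *: e i) = \sum_(i <- s) a i * p (e i) /\
  p (- \sum_(i <- s) a i *: e i) = - p (\sum_(i <- s) a i *: e i).
Proof.
move=> sp pe; elim: s => [|i s [IH1 IH2]].
  by rewrite !big_nil oppr0 (sublinear0 sp) oppr0.
rewrite !big_cons -IH1.
have [h1 h2] := sublinear_oddZ (a i) sp (pe i).
by have [-> ->] := sublinear_oddD sp h2 IH2; rewrite h1.
Qed.

End sublinear.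

(** * Quadratic forms *)

Section quadratic_forms.
Context (R : realType) (K : nat).
Implicit Types (A B S : 'M[R]_K) (u : 'cV[R]_K).

Definition qform A u : R := (u^T *m A *m u) 0 0.

Lemma qformE A u : qform A u = \sum_i \sum_j A i j * (u i 0 * u j 0).
Proof.
rewrite /qform mxE exchange_big /=; apply: eq_bigr => j _.
rewrite mxE mulr_suml; apply: eq_bigr => i _; rewrite mxE; ring.
Qed.

Lemma qformD A B u : qform (A + B) u = qform A u + qform B u.
Proof. by rewrite /qform mulmxDr mulmxDl mxE. Qed.

Lemma qformN A u : qform (- A) u = - qform A u.
Proof. by rewrite /qform mulmxN mulNmx mxE. Qed.

Lemma qformZ a A u : qform (a *: A) u = a * qform A u.
Proof. by rewrite /qform -scalemxAr -scalemxAl mxE. Qed.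

Lemma qform_scale A a u : qform A (a *: u) = a ^+ 2 * qform A u.
Proof.
by rewrite /qform [(a *: u)^T]linearZ /= -!scalemxAl -scalemxAr !mxE mulrA expr2.
Qed.

Lemma qform1 u : qform 1%:M u = \sum_i u i 0 ^+ 2.
Proof.
rewrite /qform mulmx1 mxE; apply: eq_bigr => i _.
by rewrite mxE expr2.
Qed.

Lemma qform1_ge0 u : 0 <= qform 1%:M u.
Proof. by rewrite qform1; apply: sumr_ge0 => i _; exact: sqr_ge0. Qed.

Lemma qform_outer u v : qform (u *m u^T) v = ((v^T *m u) 0 0) ^+ 2.
Proof.
rewrite /qform mulmxA -mulmxA mxE big_ord1 expr2; congr (_ * _).
by rewrite -[u^T *m v]trmxK trmx_mul trmxK mxE.
Qed.

Lemma mxtrace_mulE A B : \tr (A^T *m B) = \sum_i \sum_j A i j * B i j.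
Proof.
rewrite /mxtrace exchange_big; apply: eq_bigr => i _; rewrite mxE.
by apply: eq_bigr => j _; rewrite mxE.
Qed.

Lemma mxtrace_outer A u : \tr (A^T *m (u *m u^T)) = qform A u.
Proof.
rewrite mxtrace_mulE qformE; apply: eq_bigr => i _; apply: eq_bigr => j _.
by rewrite mxE big_ord1 !mxE.
Qed.

Lemma qform_bound A : exists2 C : R, 0 <= C &
  forall u, `|qform A u| <= C * qform 1%:M u.
Proof.
exists (\sum_i \sum_j `|A i j|); first by do 2 (apply: sumr_ge0 => ? _).
move=> u; rewrite qformE; apply: le_trans (ler_norm_sum _ _ _) _.
rewrite mulr_suml; apply: ler_sum => i _.
apply: le_trans (ler_norm_sum _ _ _) _.
rewrite mulr_suml; apply: ler_sum => j _.
rewrite normrM; apply: ler_wpM2l => //.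
have hi k : u k 0 ^+ 2 <= qform 1%:M u.
  by rewrite qform1 (bigD1 k)//= lerDl; apply: sumr_ge0 => l _; exact: sqr_ge0.
rewrite ler_norml; apply/andP; split; have := hi i; have := hi j; nra.
Qed.

(* Eliminating the coordinates one by one splits off the rank-one matrices
   A e_k e_k^T A / A_kk, on which the pairing is a value of the form B. *)
Lemma psdmx_mxtrace_ge0 A B : psdmx A -> psdmx B -> 0 <= \tr (A^T *m B).
Proof.
move=> pA [Bs pB].
(* Induction on the number n of trailing rows that may be nonzero; each step clears row K - n - 1,
   whose diagonal entry is the pivot [a]. *)
suff : forall n A, psdmx A -> (forall i j : 'I_K, (i < K - n)%N -> A i j = 0) ->
    0 <= \tr (A^T *m B).
  by move=> /(_ K A pA); apply=> i j; rewrite subnn.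
elim=> [|n IH] {pA}A [As pA] A0.
  rewrite (_ : A = 0) ?trmx0 ?mul0mx ?mxtrace0//.
  by apply/matrixP => i j; rewrite mxE A0// subn0.
have [nK|Kn] := ltnP n K; last first.
  by apply: IH => // i j h; apply: A0; move: h; rewrite (eqP Kn).
have kK : (K - n.+1 < K)%N by rewrite ltn_subrL; case: K nK.
pose k := Ordinal kK; pose a := A k k; pose c := col k A.
have cE i : c i 0 = A i k by rewrite mxE.
have Asym i j : A i j = A j i by rewrite -[in LHS]As mxE.
pose e : 'cV[R]_K := delta_mx k 0.
have a0 : 0 <= a.
  have := pA (e).
  by rewrite -/(qform _ _) /qform /e trmx_delta -rowE -colE !mxE.
have shift s u : qform A (u - s *: e) =
    qform A u - s * (u^T *m c) 0 0 *+ 2 + s ^+ 2 * a.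
  have h1 : (u^T *m A *m e) 0 0 = (u^T *m c) 0 0.
    by rewrite -mulmxA -colE.
  have h2 : ((e)^T *m A *m u) 0 0 = (u^T *m c) 0 0.
    have -> : (e^T *m A *m u) 0 0 = (e^T *m A *m u)^T 0 0 by rewrite [RHS]mxE.
    by rewrite !trmx_mul trmxK As mulmxA.
  have h3 : ((e)^T *m A *m e) 0 0 = a.
    by rewrite /e trmx_delta -rowE -colE !mxE.
  have uT : (u - s *: e)^T = u^T - s *: e^T by rewrite linearB linearZ.
  rewrite /qform uT !mulmxBl !mulmxBr -!scalemxAl -!scalemxAr.
  have mxB (X Y : 'M[R]_1) : (X - Y) 0 0 = X 0 0 - Y 0 0 by rewrite !mxE.
  have mxZ b (X : 'M[R]_1) : (b *: X) 0 0 = b * X 0 0 by rewrite mxE.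
  move: h1 h2 h3; set X2 := u^T *m A *m e; set X3 := e^T *m A *m u.
  set X4 := e^T *m A *m e; set X1 := u^T *m A *m u => <- e2 <-.
  by rewrite !(mxB, mxZ) e2; ring.
have [ak0|ak0] := eqVneq a 0.
  apply: IH => // i j iK; have [/A0//|Ki] := ltnP i (K - n.+1).
  have -> : i = k.
    by apply/val_inj/eqP; rewrite eqn_leq Ki andbT -ltnS subnSK.
  apply/eqP; apply: contraT => Akj0.
  pose x := A k j.
  (* With a zero pivot the form is affine in the coefficient of [e]. This coefficient gives the
     value -1, so a zero pivot forces its whole row to vanish. *)
  have := pA (delta_mx j 0 - ((A j j + 1) / (2 * x)) *: e).
  rewrite -/(qform _ _) shift ak0 mulr0 addr0.
  have -> : qform A (delta_mx j 0) = A j j.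
    by rewrite /qform trmx_delta -rowE -colE !mxE.
  have -> : (((delta_mx j 0)^T : 'rV_K) *m c) 0 0 = x.
    by rewrite trmx_delta -rowE !mxE Asym.
  have -> : (A j j + 1) / (2 * x) * x *+ 2 = A j j + 1.
    by field.
  by rewrite opprD addrA subrr sub0r oppr_ge0 ler10.
have ap : 0 < a by rewrite lt_neqAle eq_sym ak0.
rewrite (_ : A = (A - a^-1 *: (c *m c^T)) + a^-1 *: (c *m c^T)); last first.
  by rewrite subrK.
rewrite linearD mulmxDl linearD /= addr_ge0//; last first.
  rewrite linearZ /= -scalemxAl linearZ /= mulr_ge0 ?invr_ge0//.
  have -> : \tr ((c *m c^T)^T *m B) = \tr (B^T *m (c *m c^T)).
    by rewrite trmx_mul trmxK Bs mxtrace_mulC.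
  by rewrite mxtrace_outer; exact: pB.
apply: IH => [|i j iK].
  split=> [|u]; first by rewrite linearB linearZ /= trmx_mul trmxK As.
  rewrite -/(qform _ _) qformD qformN qformZ qform_outer.
  (* The coefficient minimises the form along [e]; the minimum is the form of the Schur complement
     at [u]. *)
  have := pA (u - ((u^T *m c) 0 0 / a) *: e).
  rewrite -/(qform _ _) shift; set z := (u^T *m c) 0 0.
  have -> : qform A u - z / a * z *+ 2 + (z / a) ^+ 2 * a =
    qform A u - a^-1 * z ^+ 2 by field.
  by [].
rewrite !mxE big_ord1 !mxE.
have [iK'|Ki] := ltnP i (K - n.+1); first by rewrite !(A0 i _ iK') mul0r mulr0 subr0.
have -> : i = k.
  by apply/val_inj/eqP; rewrite eqn_leq Ki andbT -ltnS subnSK.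
by rewrite (Asym j k) -/a mulrA mulVf// mul1r subrr.
Qed.

Lemma qform_continuous A : continuous (fun v : 'rV[R]_K => qform A v^T).
Proof.
rewrite (_ : (fun _ => _) = (fun v : 'rV[R]_K =>
    \sum_i \sum_j A i j * (v 0 i * v 0 j))); last first.
  apply/funext => w; rewrite qformE; apply: eq_bigr => i _.
  by apply: eq_bigr => j _; rewrite !mxE.
have addc : continuous (fun x : R * R => x.1 + x.2) by exact: add_continuous.
apply: (@continuous_big R _ +%R 0 xpredT addc) => i _.
apply: (@continuous_big R _ +%R 0 xpredT addc) => j _ v.
apply: (@cvgM R _ (nbhs v) _ (cst (A i j))); first exact: cvg_cst.
by apply: (@cvgM R); exact: coord_continuous.
Qed.

(** The constant is the minimum of the form on the compact unit sphere, carried to all vectors by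
    homogeneity of degree two. *)
Lemma pdmx_coercive A : pdmx A ->
  exists2 e : R, 0 < e & forall u, e * qform 1%:M u <= qform A u.
Proof.
move=> [_ pA].
pose D := [set v : 'rV[R]_K | qform 1%:M v^T = 1].
(* The sphere is empty only if every vector is zero, that is for K = 0; then any constant works. *)
have [D0|D0] := pselect (D !=set0); last first.
  have u0 u : u = 0.
    apply/eqP; apply: contrapT => /negP un0; apply: D0.
    have qu : 0 < qform 1%:M u.
      rewrite lt_neqAle qform1_ge0 andbT eq_sym; apply: contra un0.
      rewrite qform1 psumr_eq0 => [|i _]; last exact: sqr_ge0.
      move=> /allP h; apply/eqP/matrixP => i j; rewrite (ord1 j) mxE.
      by apply/eqP; have := h i (mem_index_enum _); rewrite sqrf_eq0.
    exists ((Num.sqrt (qform 1%:M u))^-1 *: u)^T; rewrite /D /= trmxK.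
    by rewrite qform_scale exprVn sqr_sqrtr ?mulVf ?gt_eqF// ltW.
  by exists 1 => // u; rewrite (u0 u) /qform !mulmx0 mxE mulr0.
have cD : compact D.
  apply: bounded_closed_compact.
    exists 1; split => // M M1 v Dv.
    rewrite /= [leLHS]/Num.norm /= mx_normrE; apply/bigmax_leP; split => [|[i j] _].
      by rewrite (le_trans ler01)// ltW.
    rewrite /= (ord1 i); apply: le_trans _ (ltW M1).
    rewrite -(@ler_pXn2r _ 2) ?nnegrE// expr1n real_normK ?num_real//.
    rewrite -Dv qform1 (bigD1 j)//= mxE lerDl; apply: sumr_ge0 => l _.
    exact: sqr_ge0.
  rewrite (_ : D = (fun v : 'rV[R]_K => qform 1%:M v^T) @^-1` [set 1]) //.
  by apply: closed_comp => [v _|]; [exact: qform_continuous|exact: closed_eq].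
have [v] := EVT_min_rV D0 cD (continuous_subspaceT (@qform_continuous A)).
rewrite inE => Dv vmin.
have v0 : v^T != 0.
  by apply/eqP => v0; move: Dv; rewrite /D/= v0 /qform mulmx0 mxE => /eqP;
    rewrite eq_sym oner_eq0.
exists (qform A v^T); first exact: pA.
move=> u; have := qform1_ge0 u; rewrite le_eqVlt => /orP[/eqP q0|q0].
  rewrite -q0 mulr0; have [->|un0] := eqVneq u 0; last exact/ltW/pA.
  by rewrite /qform mulmx0 mxE.
have qs0 : Num.sqrt (qform 1%:M u) != 0 by rewrite sqrtr_eq0 -ltNge.
have := vmin ((Num.sqrt (qform 1%:M u))^-1 *: u)^T.
rewrite inE /D /= trmxK !qform_scale exprVn sqr_sqrtr ?qform1_ge0// => /(_ _)/wrap[].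
  by rewrite mulVf// gt_eqF.
by rewrite [X in _ <= X -> _]mulrC ler_pdivlMr.
Qed.

End quadratic_forms.

(** * Lagrange multipliers *)

Section lagrange.
Context (R : realType) (K : nat) (P : Type) (J c : P -> R) (M : P -> 'M[R]_K).
Context (r0 v : R) (Sigma : 'M[R]_K) (g0 : P) (e0 : R).
(** Convexity of the set of plans enters only through the images under [J], [c] and [M], so that [P]
    can be a bare type of measures. *)
Hypothesis mixP : forall g1 g2 t, 0 < t < 1 -> exists g,
  [/\ J g = t * J g1 + (1 - t) * J g2, c g = t * c g1 + (1 - t) * c g2 &
      M g = t *: M g1 + (1 - t) *: M g2].
Hypothesis bounded : forall g, c g <= r0 ->
  (forall u, qform (M g) u <= qform Sigma u) -> J g <= v.
Hypotheses (slater_c : c g0 < r0) (e0_gt0 : 0 < e0).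
Hypothesis slater_M : forall u,
  qform (M g0) u + e0 * qform 1%:M u <= qform Sigma u.
Hypotheses (M_sym : forall g, (M g)^T = M g) (Sigma_sym : Sigma^T = Sigma).

Let V : lmodType R := (R^o * 'M[R]_K)%type.

Let feas (x : V) t g := c g <= r0 + t * x.1 /\
  forall u, qform (M g) u <= qform Sigma u + t * qform x.2 u.

Let E (x : V) := [set y | exists t g, [/\ 0 < t, feas x t g & y = (v - J g) / t]].

(** Strict feasibility is used here: the slack of [g0] absorbs a short step in any direction x,
    uniformly in u because a quadratic form is bounded by a multiple of the identity form. *)
Let E_neq0 x : E x !=set0.
Proof.
have [C C0 hC] := qform_bound x.2.
pose t := Num.min ((r0 - c g0) / (`|x.1| + 1)) (e0 / (C + 1)).
have a1 : 0 < `|x.1| + 1 by rewrite ltr_wpDl.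
have t0 : 0 < t.
  by rewrite lt_min !divr_gt0 ?subr_gt0// ltr_wpDl.
exists ((v - J g0) / t), t, g0; split => //; split => [|u].
  have : t <= (r0 - c g0) / (`|x.1| + 1) by rewrite ge_min lexx.
  rewrite ler_pdivlMr// => h.
  have := ler_norm (- x.1); rewrite normrN => h2; nra.
have : t <= e0 / (C + 1) by rewrite ge_min lexx orbT.
rewrite ler_pdivlMr ?ltr_wpDl// => h.
have h1 := slater_M u; have q0 := qform1_ge0 u.
have := hC u; have := ler_norm (- qform x.2 u); rewrite normrN => h2 h3.
have : - qform x.2 u <= C * qform 1%:M u by exact: le_trans h2 h3.
nra.
Qed.

Let E_add x y a b : E x a -> E y b -> E (x + y) (a + b).
Proof.
move=> [t1 [g1 [t10 [f1 f1'] ->]]] [t2 [g2 [t20 [f2 f2'] ->]]].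
have t120 : 0 < t1 + t2 by exact: addr_gt0.
have tn : t1 + t2 != 0 by rewrite gt_eqF.
have n1 : t1 != 0 by rewrite gt_eqF.
have n2 : t2 != 0 by rewrite gt_eqF.
(* These weights give s t1 = (1 - s) t2 = t1 t2 / (t1 + t2). With this common step the mixture is
   feasible along x + y, and its quotient is exactly a + b. *)
pose s := t2 / (t1 + t2).
have s1 : 1 - s = t1 / (t1 + t2) by rewrite /s; field.
have s01 : 0 < s < 1.
  by rewrite divr_gt0//= ltr_pdivrMr// mul1r ltrDr.
have [g [Jg cg Mg]] := mixP g1 g2 s01.
exists (t1 * t2 / (t1 + t2)), g; split.
- by rewrite divr_gt0 ?mulr_gt0.
- split=> [|u].
    rewrite cg.
    have -> : r0 + t1 * t2 / (t1 + t2) * (x + y).1 =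
        s * (r0 + t1 * x.1) + (1 - s) * (r0 + t2 * y.1).
      by rewrite s1 /s /=; field.
    by apply: lerD; apply: ler_wpM2l => //; lra.
  rewrite Mg !qformD !qformZ.
  have -> : qform Sigma u + t1 * t2 / (t1 + t2) * (qform x.2 u + qform y.2 u) =
      s * (qform Sigma u + t1 * qform x.2 u) +
      (1 - s) * (qform Sigma u + t2 * qform y.2 u).
    by rewrite s1 /s /=; field.
  by apply: lerD; apply: ler_wpM2l => //; lra.
- by rewrite Jg s1 /s; field; rewrite n1 n2 tn.
Qed.

Let E_scale x a b : 0 < b -> E x a -> E (b *: x) (b * a).
Proof.
move=> b0 [t [g [t0 [f f'] ->]]]; exists (t / b), g.
have bn : b != 0 by rewrite gt_eqF.
have tn : t != 0 by rewrite gt_eqF.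
split; [by rewrite divr_gt0| |by field; rewrite tn bn].
split=> [|u]; first by rewrite /= /GRing.scale /= mulrA divfK.
by rewrite /= qformZ mulrA divfK.
Qed.

Let E0_ge0 a : E 0 a -> 0 <= a.
Proof.
move=> [t [g [t0 [f f'] ->]]]; rewrite divr_ge0 ?(ltW t0)// subr_ge0.
apply: bounded => [|u]; first by move: f; rewrite /= mulr0 addr0.
by have := f' u; rewrite /= /qform mulmx0 mul0mx [X in _ * X]mxE mulr0 addr0.
Qed.

(** A quotient along x and one along - x add up to a quotient along 0, which is nonnegative since
    [v] bounds the gain of feasible points. *)
Let E_lb x : has_lbound (E x).
Proof.
have [b Eb] := E_neq0 (- x); exists (- b) => a Ea.
by have := E0_ge0 _; move=> /(_ (a + b)); rewrite -(subrr x) => /(_ (E_add Ea Eb)); lra.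
Qed.

Let p x := inf (E x).

Let p_le x a : E x a -> p x <= a.
Proof. by move=> Ea; apply: ge_inf. Qed.

Let p_sublinear : sublinear p.
Proof.
split=> [x y|t x t0].
  apply/ler_addgt0Pl => eps eps0.
  have e2 := divr_gt0 eps0 (ltr0n _ 2).
  have [a Ea ha] := inf_adherent e2 (conj (E_neq0 x) (E_lb x)).
  have [b Eb hb] := inf_adherent e2 (conj (E_neq0 y) (E_lb y)).
  have := p_le (E_add Ea Eb); rewrite -/(p x) -/(p y) in ha hb; lra.
have le_h (a : R) y : 0 < a -> p (a *: y) <= a * p y.
  move=> a0; rewrite -ler_pdivrMl//; apply: lb_le_inf => [|z Ez]; first exact: E_neq0.
  by rewrite ler_pdivrMl//; exact/p_le/E_scale.
apply/eqP; rewrite eq_le le_h//=.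
have := @le_h t^-1 (t *: x); rewrite invr_gt0 scalerA mulVf ?gt_eqF// scale1r.
by move=> /(_ t0); rewrite ler_pdivlMl// mulrC.
Qed.

(* p is the directional derivative at 0 of the convex function that sends a
   perturbation of the constraints to v minus the optimal value; a linear
   minorant of p supplies the multipliers. *)
Lemma lagrange_multipliers : exists (lambda : R) (Lambda : 'M[R]_K),
  [/\ 0 <= lambda, psdmx Lambda & forall g,
    J g <= v + lambda * (c g - r0) + \tr (Lambda^T *m (M g - Sigma))].
Proof.
pose d (ij : 'I_K * 'I_K) : V := (0, delta_mx ij.1 ij.2).
pose s : seq V := (1, 0) :: [seq d ij | ij : 'I_K * 'I_K].
have [q [sq qp qs]] := sublinear_linearize_seq s p_sublinear.
have qd ij : q (- d ij) = - q (d ij).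
  by apply: qs; rewrite inE; apply/orP; right; apply/mapP; exists ij; rewrite ?mem_enum.
have q1 : q (- (1, 0)) = - q (1, 0) by apply: qs; rewrite inE eqxx.
pose L : 'M[R]_K := \matrix_(i, j) - q (d (i, j)).
have qE (x : V) : q x = x.1 * q (1, 0) - \sum_i \sum_j L i j * x.2 i j.
  have [h1 h1'] := sublinear_oddZ x.1 sq q1.
  have [h2 h2'] := sublinear_odd_sum (index_enum _)
    (fun ij : 'I_K * 'I_K => x.2 ij.1 ij.2) sq qd.
  have {1}-> : x = x.1 *: ((1, 0) : V) + \sum_ij x.2 ij.1 ij.2 *: d ij.
    rewrite [RHS]surjective_pairing [LHS]surjective_pairing; congr pair.
      rewrite /= raddf_sum big1 => [|ij _]; last by rewrite /= scaler0.
      by rewrite addr0 /GRing.scale /= mulr1.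
    rewrite /= raddf_sum /= scaler0 add0r -(pair_bigA _ (fun i j => x.2 i j *: delta_mx i j)).
    by rewrite -matrix_sum_delta.
  have [-> _] := sublinear_oddD sq h1' h2'; rewrite h1 h2; congr (_ + _).
  rewrite -(pair_bigA _ (fun i j => x.2 i j * q (d (i, j)))) /= -sumrN.
  apply: eq_bigr => i _; rewrite -sumrN; apply: eq_bigr => j _.
  by rewrite mxE mulNr opprK mulrC.
(* If [g0] stays feasible for all steps t along x, its quotients (v - J g0) / t tend to 0. Relaxing
   a constraint is such a direction, whence the signs of both multipliers. *)
have q_le0 (x : V) : (forall t, 0 < t -> feas x t g0) -> q x <= 0.
  move=> fx; rewrite leNgt; apply/negP => qx0.
  have h t : 0 < t -> q x * t <= v - J g0.
    move=> t0; rewrite -ler_pdivlMr//; apply: le_trans (qp x) (p_le _).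
    by exists t, g0; split => //; exact: fx.
  pose t := (`|v - J g0| + 1) / q x.
  have t0 : 0 < t by rewrite divr_gt0// ltr_wpDl.
  have := h t t0; rewrite /t mulrC divfK ?gt_eqF//.
  have := ler_norm (v - J g0); lra.
have slM u : qform (M g0) u <= qform Sigma u.
  apply: le_trans _ (slater_M u); rewrite lerDl mulr_ge0 ?qform1_ge0//.
  exact: ltW.
(* The slopes [L] come from the elementary matrices and need not be symmetric; symmetrising changes
   no pairing with a symmetric matrix. *)
pose Lambda := 2^-1 *: (L + L^T).
have trE (A : 'M[R]_K) : A^T = A -> \tr (Lambda^T *m A) = \sum_i \sum_j L i j * A i j.
  move=> As; rewrite -mxtrace_mulE.
  have -> : Lambda^T = Lambda by rewrite linearZ linearD /= trmxK addrC.
  rewrite -scalemxAl linearZ mulmxDl linearD /=.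
  have -> : \tr (L *m A) = \tr (L^T *m A).
    by rewrite -[LHS]mxtrace_tr trmx_mul As mxtrace_mulC.
  by field.
exists (- q (1, 0)), Lambda; split.
- rewrite oppr_ge0; apply: q_le0 => t t0; split => [|u] /=.
    by rewrite mulr1; have := slater_c; lra.
  by rewrite /qform mulmx0 mul0mx [X in _ * X]mxE mulr0 addr0; exact: slM.
- split=> [|u]; first by rewrite linearZ linearD /= trmxK addrC.
  rewrite -/(qform _ _) -mxtrace_outer trE ?trmx_mul ?trmxK//.
  have := q_le0 (0, u *m u^T); rewrite qE /= mul0r sub0r oppr_le0; apply=> t t0.
  split => [|w] /=; first by rewrite mulr0 addr0 ltW.
  by apply: le_trans (slM w) _; rewrite lerDl mulr_ge0 ?(ltW t0)// qform_outer sqr_ge0.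
- move=> g; rewrite trE; last by rewrite linearB /= M_sym Sigma_sym.
  (* Every [g] is feasible at step 1 along its own constraint residual. *)
  pose x : V := (c g - r0, M g - Sigma).
  have : q x <= v - J g.
    apply: le_trans (qp x) (p_le _); exists 1, g; split => //; last by rewrite divr1.
    by split=> [|u]; rewrite mul1r /= ?qformD ?qformN; rewrite addrC subrK.
  by rewrite qE /=; lra.
Qed.

End lagrange.

(** * Measurable selections in metric spaces *)

Section generated.
Context (R : realType).

Lemma measurable_g_sigma (T : pointedType) (G : set (set T)) (A : set T) :
  G A -> measurable (A : set (g_sigma_algebraType G)).
Proof. by move=> GA; apply: sub_sigma_algebra. Qed.

Lemma measurable_fun_g_sigma (dsp : measure_display) (S : measurableType dsp)
    (T : pointedType) (G : set (set T)) (f : S -> g_sigma_algebraType G) :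
  (forall A : set T, G A -> measurable (f @^-1` A)) -> measurable_fun setT f.
Proof.
move=> fG; apply: (@measurability _ _ _ _ setT f G) => //.
by move=> _ [A GA <-]; rewrite setTI; exact: fG.
Qed.

Lemma emeasurable_fun_g_sigma (T : pointedType) (G : set (set T))
    (f : T -> \bar R) : (forall a : R, G [set x | (a%:E < f x)%E]) ->
  measurable_fun [set: g_sigma_algebraType G] f.
Proof.
move=> fG; apply: (measurability _ (ErealGenOInfty.measurableE R)) => //.
move=> _ [_ [a ->] <-]; rewrite setTI.
rewrite (_ : _ @^-1` _ = [set x | (a%:E < f x)%E]); last first.
  by apply/seteqP; split => x /=; rewrite in_itv /= andbT.
by apply: (@measurable_g_sigma T G); exact: fG.
Qed.

Lemma usc_measurable (T : ptopologicalType) (f : T -> R) :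
  upper_semicontinuous f -> measurable_fun [set: borel T] f.
Proof.
move=> fusc; apply: (measurability _ (RGenInftyO.measurableE R)) => //.
move=> _ [_ [a ->] <-]; rewrite setTI.
apply: (@measurable_g_sigma T open (f @^-1` _)); rewrite openE => x /=.
rewrite in_itv /= => fxa.
by apply: filterS (fusc x a fxa) => y; rewrite /= in_itv.
Qed.

End generated.

Section selection.
Context (R : realType) (X : pseudoPMetricType R).

(* Montgomery's argument, which needs no separability: with the least index as
   selection, the points whose 1/n-ball lies in the selected open set form
   1/n-separated families, so that their union over all indices differs from a
   closed set only inside the set to be measured. *)
Lemma open_cover_selection (U : X -> set X) : (forall xi, open (U xi)) ->
  exists S : X -> X, (forall z xi, U xi z -> U (S z) z) /\
    forall W : set (X * X), open W ->
      measurable ([set z | U (S z) z /\ W (S z, z)] : set (borel X)).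
Proof.
move=> oU; have [r rwo] := wochoice.well_ordering_principle X.
have rxx x : r x x.
  have [|z [[]]] := rwo (pred1 x); first by exists x; rewrite inE.
  by rewrite inE => /eqP-> h _; apply: h; rewrite inE.
have anti x y : r x y -> r y x -> x = y.
  move=> rxy ryx; have [|z [_ uz]] := rwo (pred2 x y).
    by exists x; rewrite inE /= eqxx.
  rewrite -(uz x) ?(uz y)//; split; rewrite ?inE ?eqxx ?orbT//;
    by move=> w; rewrite inE => /orP[]/eqP->.
have /choice[S hS] : forall z, exists s, forall xi, U xi z ->
    U s z /\ r s xi.
  move=> z; have [[x0 Ux0]|nU] := pselect (exists x0, U x0 z); last first.
    by exists z => xi Uxi; exfalso; apply: nU; exists xi.
  have [|s [[sU sm] _]] := rwo (fun x => `[< U x z >]).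
    by exists x0; rewrite /in_mem /=; apply/asboolP.
  exists s => xi Uxi; split; first by apply/asboolP.
  by apply: sm; rewrite /in_mem /=; apply/asboolP.
exists S; split => [z xi /hS[]//|W oW].
pose G (n : nat) := [set z | U (S z) z /\
  (ball z (n.+1%:R^-1) `<=` [set y | U (S z) y /\ W (S z, y)])].
rewrite (_ : [set z | _ /\ _] = \bigcup_n closure (G n)); last first.
  apply/seteqP; split => [z [Uz Wz]|z [n _ clz]].
    have oUW : open [set y | U (S z) y /\ W (S z, y)].
      apply: openI; first exact: oU.
      have /continuousP/(_ W oW) : continuous (fun y : X => (S z, y)).
        by move=> y; apply: cvg_pair; [exact: cvg_cst|exact: cvg_id].
      by [].
    have := open_nbhs_nbhs (conj oUW (conj Uz Wz)).
    move=> /nbhs_ballP[e /= e0 he].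
    have [n hn] : exists n, n.+1%:R^-1 < e.
      exists (Num.truncn e^-1); rewrite invf_plt ?posrE//.
      exact: truncnS_gt.
    exists n => //; apply: subset_closure; split => //.
    by apply: subset_trans he; apply: le_ball; exact: ltW.
  pose r0 : R := n.+1%:R^-1.
  have r00 : 0 < r0 by rewrite invr_gt0.
  have half (A : set X) : nbhs z A ->
      exists x, [/\ G n x, ball z (r0 / 2) x & A x].
    move=> nA; have /clz[x [Gx [bx Ax]]] : nbhs z (ball z (r0 / 2) `&` A).
      by apply: filterI => //; apply: nbhsx_ballx; exact: divr_gt0.
    by exists x.
  have [z1 [Gz1 bz1 _]] := half setT filterT.
  (* Two points of [G n] near z lie in each other's [r0]-ball, so each lies in the set selected by
     the other. Least indices then compare both ways and coincide. *)
  have same x y : G n x -> ball z (r0 / 2) x -> G n y -> ball z (r0 / 2) y ->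
      r (S y) (S x).
    move=> [Ux Gx] bx [Uy Gy] byy.
    have xy : ball x r0 y.
      by rewrite [r0]splitr; apply: ball_triangle byy; exact: ball_sym.
    by have [/hS[]] := Gx _ xy.
  have b1z : ball z1 r0 z.
    by apply: ball_sym; apply: le_ball bz1; lra.
  have [Uz Wz] := Gz1.2 _ b1z.
  have [USz rz] := hS z _ Uz.
  suff e : S z = S z1 by split; rewrite e.
  apply: (anti) => //.
  (* For the reverse comparison: a point x of [G n] close to z falls into the open set [U (S z)], so
     its least index, which is [S z1], precedes [S z]. *)
  have [x [Gx bx Ux]] := half _ (open_nbhs_nbhs (conj (oU (S z)) USz)).
  have -> : S z1 = S x by apply: anti; exact: same.
  by have [] := hS x _ Ux.
apply: bigcup_measurable => n _.
rewrite -[X in measurable X](setCK (closure _)); apply: measurableC.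
apply: (@measurable_g_sigma X open); apply: closed_openC.
exact: closed_closure.
Qed.

(** A rational [a n] strictly between h z and some f xi z reduces the choice to countably many open
    covers {f xi > a n}; T z follows the cover of the first rational that fits z. *)
Lemma measurable_selection (f : X -> X -> R) (h : X -> R) :
  (forall xi a, open [set z | a < f xi z]) ->
  measurable_fun [set: borel X] h ->
  (forall z, exists xi, h z < f xi z) ->
  exists T : X -> X,
    measurable_fun [set: borel X] (fun z : borel X => (T z, z) : borel (X * X)) /\
    forall z, h z < f (T z) z.
Proof.
move=> of_ mh hf.
pose a (n : nat) : R := if (unpickle n : option rat) is Some q then ratr q else 0.
have /choice[S hS] : forall n, exists S : X -> X,
    (forall z xi, a n < f xi z -> a n < f (S z) z) /\
    forall W : set (X * X), open W ->
      measurable ([set z | a n < f (S z) z /\ W (S z, z)] : set (borel X)).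
  by move=> n; exact: (open_cover_selection (fun xi => of_ xi (a n))).
pose P n z := h z < a n /\ a n < f (S n z) z.
have Pex z : exists n, `[< P n z >].
  have [xi hxi] := hf z; have [q] := rat_in_itvoo hxi.
  rewrite in_itv /= => /andP[hq qf]; exists (pickle q); apply/asboolP.
  have aq : a (pickle q) = ratr q by rewrite /a pickleK.
  by split; [rewrite aq|apply: (hS _).1; rewrite aq; exact: qf].
pose N z := ex_minn (Pex z).
have NP z : P (N z) z by rewrite /N; case: ex_minnP => n /asboolP.
exists (fun z => S (N z) z); split; last first.
  by move=> z; have [] := NP z; exact: lt_trans.
have mP n (W : set (X * X)) : open W ->
    measurable ([set z | P n z /\ W (S n z, z)] : set (borel X)).
  move=> oW; rewrite (_ : [set _ | _] =
      [set z | h z < a n] `&` [set z | a n < f (S n z) z /\ W (S n z, z)]).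
    apply: measurableI; last by have [_] := hS n; apply.
    rewrite -[X in measurable X]setTI.
    have -> : [set z | h z < a n] = h @^-1` `]-oo, a n[%classic.
      by apply/seteqP; split => z /=; rewrite in_itv.
    exact: mh.
  by apply/seteqP; split => z /=; rewrite /P; tauto.
have mPT n : measurable ([set z | P n z] : set (borel X)).
  rewrite (_ : [set _ | _] = [set z | P n z /\ [set: X * X] (S n z, z)]).
    by apply: mP; exact: openT.
  by apply/seteqP; split => z //= [].
apply: (@measurable_fun_g_sigma _ (borel X) (X * X)%type) => W oW.
rewrite (_ : _ @^-1` _ = \bigcup_n ([set z | P n z /\ W (S n z, z)] `\`
    \bigcup_(m < n) [set z | P m z])).
  apply: bigcup_measurable => n _; apply: measurableD; first exact: mP.
  exact: bigcup_measurable.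
apply/seteqP; split => z /=.
  move=> Wz; exists (N z) => //; split; first by split; [exact: NP|].
  move=> [m /= mN Pm]; move: mN; rewrite /N; case: ex_minnP => k _ kmin.
  by rewrite ltnNge kmin//; apply/asboolP.
move=> [n _ [[Pn Wn] nP]]; suff -> : N z = n by [].
rewrite /N; case: ex_minnP => k /asboolP Pk kmin.
apply/eqP; rewrite eqn_leq kmin ?andTb; last exact/asboolP.
by rewrite leqNgt; apply/negP => kn; apply: nP; exists k.
Qed.

End selection.

(** * Measures on a product with a prescribed second marginal *)

Section integral_combination.
Context (dsp : measure_display) (T : measurableType dsp) (R : realType).
Implicit Types m : {measure set T -> \bar R}.
Local Open Scope ereal_scope.

Lemma ge0_integral_mrestr m (D : set T) (mD : measurable D) (g : T -> \bar R) :
  measurable_fun setT g -> (forall x, 0 <= g x) ->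
  \int[mrestr m mD]_x g x = \int[m]_(x in D) g x.
Proof.
move=> mg g0; rewrite -(setUv D) ge0_integral_setU//=; first last.
- by apply/disj_set2P; rewrite setICr.
- by rewrite setUv.
- exact: measurableC.
rewrite (eq_measure_integral m) => [|A mA AD]; last first.
  by rewrite /= /mrestr setIidl.
rewrite [X in _ + X](eq_measure_integral mzero) ?integral_measure_zero ?adde0//.
move=> A mA AD; rewrite /= /mrestr /mzero (_ : A `&` D = set0) ?measure0//.
by apply/disjoints_subset.
Qed.

(** One construction serves two purposes: convex mixtures when [D1] and [D2] are everything, and
    gluing along a partition when both weights are 1. *)
Definition comb (a b : {nonneg R}) m1 m2 (D1 D2 : set T)
    (mD1 : measurable D1) (mD2 : measurable D2) : {measure set T -> \bar R} :=
  measure_add (mscale a (mrestr m1 mD1)) (mscale b (mrestr m2 mD2)).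

Context (a b : {nonneg R}) (m1 m2 : {measure set T -> \bar R}) (D1 D2 : set T)
  (mD1 : measurable D1) (mD2 : measurable D2).
Let m := comb a b m1 m2 mD1 mD2.

Lemma combE (A : set T) :
  m A = a%:num%:E * m1 (A `&` D1) + b%:num%:E * m2 (A `&` D2).
Proof. exact: measure_addE. Qed.

Lemma ge0_integral_comb (g : T -> \bar R) :
  measurable_fun setT g -> (forall x, 0 <= g x) ->
  \int[m]_x g x = a%:num%:E * \int[m1]_(x in D1) g x +
                  b%:num%:E * \int[m2]_(x in D2) g x.
Proof.
move=> mg g0; rewrite ge0_integral_measure_add//.
by rewrite !ge0_integral_mscale// !ge0_integral_mrestr.
Qed.

Lemma integral_comb (f : T -> R) : measurable_fun setT f ->
  m1.-integrable D1 (EFin \o f) -> m2.-integrable D2 (EFin \o f) ->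
  m.-integrable setT (EFin \o f) /\
  \int[m]_x (f x)%:E = a%:num%:E * \int[m1]_(x in D1) (f x)%:E +
                       b%:num%:E * \int[m2]_(x in D2) (f x)%:E.
Proof.
move=> mf i1 i2; have mEf : measurable_fun setT (EFin \o f) by exact/measurable_EFinP.
have fin1 (g : T -> \bar R) : m1.-integrable D1 g -> \int[m1]_(x in D1) g x \is a fin_num.
  by move=> ig; exact: integrable_fin_num.
have fin2 (g : T -> \bar R) : m2.-integrable D2 g -> \int[m2]_(x in D2) g x \is a fin_num.
  by move=> ig; exact: integrable_fin_num.
split.
  apply/integrableP; split => //.
  rewrite ge0_integral_comb//; last exact: measurableT_comp.
  have /integrableP[_ h1] := i1; have /integrableP[_ h2] := i2.
  by apply: lte_add_pinfty; apply: lte_mul_pinfty.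
rewrite integralE [\int[m1]_(x in D1) _]integralE [\int[m2]_(x in D2) _]integralE.
rewrite !ge0_integral_comb//; [|exact: measurable_funeneg|exact: measurable_funepos].
have p1 := fin1 _ (integrable_funepos mD1 i1); have n1 := fin1 _ (integrable_funeneg mD1 i1).
have p2 := fin2 _ (integrable_funepos mD2 i2); have n2 := fin2 _ (integrable_funeneg mD2 i2).
move: p1 n1 p2 n2.
do 4 (set X := (integral _ _ _); move: X); move=> [n2| |] // [p2| |] // [n1| |] // [p1| |] // _ _ _ _.
by rewrite -!(EFinM, EFinN, EFinD); congr EFin; ring.
Qed.

End integral_combination.

(** By monotone convergence the integrals over [A n] increase to a finite total. This makes it cheap
    to replace a plan on the complement of [A n]. *)
Lemma ge0_integral_tail (dsp : measure_display) (T : measurableType dsp)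
    (R : realType) (m : {measure set T -> \bar R}) (g : T -> \bar R)
    (A : nat -> set T) (e : R) :
  measurable_fun setT g -> (forall x, 0 <= g x)%E ->
  (\int[m]_x g x < +oo)%E -> (forall n, measurable (A n)) ->
  {homo A : n k / (n <= k)%N >-> n `<=` k} -> \bigcup_n A n = setT -> 0 < e ->
  \forall n \near \oo, (\int[m]_(x in ~` A n) g x < e%:E)%E.
Proof.
move=> mg g0 ig mA nA UA e0.
have h : (\int[m]_(x in A n) g x)%E @[n --> \oo] --> (\int[m]_x g x)%E.
  rewrite -UA; apply: ge0_nondecreasing_set_cvg_integral => //.
  - by move=> n k nk; apply/subsetPset; exact: nA.
  - by move=> n; exact: measurable_funTS.
have Ig : (\int[m]_x g x)%E \is a fin_num.
  by rewrite ge0_fin_numE//; exact: integral_ge0.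
have split n : (\int[m]_x g x = \int[m]_(x in A n) g x + \int[m]_(x in ~` A n) g x)%E.
  rewrite -ge0_integral_setU ?setUv//; first exact: measurableC.
  by apply/disj_set2P; rewrite setICr.
have Afin n : (\int[m]_(x in A n) g x)%E \is a fin_num.
  rewrite ge0_fin_numE; last exact: integral_ge0.
  by apply: le_lt_trans ig; apply: ge0_subset_integral.
have /fine_cvgP[_ h'] : (\int[m]_(x in A n) g x)%E @[n --> \oo] -->
    (fine (\int[m]_x g x)%E)%:E by rewrite fineK.
have := h'; move=> /cvgrPdist_lt/(_ e e0); apply: filterS => n /=.
move=> hn.
have sn := split n.
have Bfin : (\int[m]_(x in ~` A n) g x)%E \is a fin_num.
  rewrite ge0_fin_numE; last exact: integral_ge0.
  by apply: le_lt_trans ig; apply: ge0_subset_integral => //; exact: measurableC.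
rewrite -(fineK Bfin) lte_fin; apply: le_lt_trans hn.
have -> : fine (\int[m]_x g x)%E - fine (\int[m]_(x in A n) g x)%E =
    fine (\int[m]_(x in ~` A n) g x)%E.
  by rewrite sn fineD//; ring.
exact: ler_norm.
Qed.

Section plans.
Context (R : realType) (X : pseudoPMetricType R) (nu : probability (borel X) R).
Local Notation Z := (borel (X * X)).

Lemma measurable_fst_borel : measurable_fun [set: Z] (fst : Z -> borel X).
Proof.
apply: (@measurable_fun_g_sigma _ Z X) => A oA.
apply: (@measurable_g_sigma (X * X)%type open).
have /continuousP : continuous (fst : X * X -> X) by move=> x; exact: cvg_fst.
exact.
Qed.

Lemma measurable_snd_borel : measurable_fun [set: Z] (snd : Z -> borel X).
Proof.
apply: (@measurable_fun_g_sigma _ Z X) => A oA.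
apply: (@measurable_g_sigma (X * X)%type open).
have /continuousP : continuous (snd : X * X -> X) by move=> x; exact: cvg_snd.
exact.
Qed.

Lemma measurable_snd_preimage (A : set (borel X)) :
  measurable A -> measurable (snd @^-1` A : set Z).
Proof. by move=> mA; rewrite -[X in measurable X]setTI; exact: measurable_snd_borel. Qed.

Lemma measurable_diag_borel :
  measurable_fun [set: borel X] (fun z : borel X => (z, z) : Z).
Proof.
apply: (@measurable_fun_g_sigma _ (borel X) (X * X)%type) => W oW.
apply: (@measurable_g_sigma X open).
have /continuousP : continuous (fun z : X => (z, z)).
  by move=> z; apply: cvg_pair; exact: cvg_id.
exact.
Qed.

Definition plan (m : {measure set Z -> \bar R}) :=
  forall A : set (borel X), measurable A -> m (snd @^-1` A) = nu A.

Lemma plan_integral_snd (m : {measure set Z -> \bar R}) (D : set (borel X))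
    (g : borel X -> \bar R) :
  plan m -> measurable D -> measurable_fun setT g -> (forall x, 0 <= g x)%E ->
  (\int[m]_(z in snd @^-1` D) g z.2 = \int[nu]_(x in D) g x)%E.
Proof.
move=> pm mD mg g0.
rewrite -(@ge0_integral_pushforward _ _ _ _ _ _ measurable_snd_borel m D g)//.
  by apply: eq_measure_integral => [|? A mA _]; [exact: measurable_snd_borel|exact: (pm A mA)].
exact: measurable_funTS.
Qed.


Section graph_plan.
Context (T : X -> X).
Hypothesis mT : measurable_fun [set: borel X] (fun z : borel X => (T z, z) : Z).

Definition graph_plan : {measure set Z -> \bar R} :=
  measure_function_pushforward__canonical__measure_function_Measure nu mT.

Lemma graph_plan_plan : plan graph_plan.
Proof. by []. Qed.

Lemma ge0_integral_graph_plan (D : set Z) (g : Z -> \bar R) :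
  measurable D -> measurable_fun setT g -> (forall x, 0 <= g x)%E ->
  (\int[graph_plan]_(z in D) g z = \int[nu]_(x in (fun z => (T z, z)) @^-1` D) g (T x, x))%E.
Proof.
move=> mD mg g0; rewrite /graph_plan ge0_integral_pushforward//.
exact: measurable_funTS.
Qed.

Lemma integral_graph_plan (D : set Z) (f : Z -> \bar R) :
  measurable D -> measurable_fun setT f ->
  (\int[graph_plan]_(z in D) f z = \int[nu]_(x in (fun z => (T z, z)) @^-1` D) f (T x, x))%E.
Proof.
move=> mD mf; rewrite integralE [RHS]integralE.
congr (_ - _)%E.
  rewrite ge0_integral_graph_plan//; last exact: measurable_funepos.
  by apply: eq_integral => x _; rewrite !funeposE.
rewrite ge0_integral_graph_plan//; last exact: measurable_funeneg.
by apply: eq_integral => x _; rewrite !funenegE.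
Qed.

End graph_plan.

Section glue.
Context (m1 m2 : {measure set Z -> \bar R}) (A : set (borel X)) (mA : measurable A).

(** The cut is made in the second coordinate, so the second marginal is kept however differently
    [m1] and [m2] move the mass. *)
Definition glued : {measure set Z -> \bar R} :=
  comb 1%:nng 1%:nng m1 m2 (measurable_snd_preimage mA)
    (measurable_snd_preimage (measurableC mA)).

Lemma ge0_integral_glued (g : Z -> \bar R) :
  measurable_fun setT g -> (forall x, 0 <= g x)%E ->
  (\int[glued]_x g x = \int[m1]_(x in snd @^-1` A) g x +
                      \int[m2]_(x in snd @^-1` (~` A)) g x)%E.
Proof. by move=> mg g0; rewrite ge0_integral_comb// !mul1e. Qed.

Lemma integral_glued (f : Z -> R) : measurable_fun setT f ->
  m1.-integrable (snd @^-1` A) (EFin \o f) ->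
  m2.-integrable (snd @^-1` (~` A)) (EFin \o f) ->
  (\int[glued]_x (f x)%:E = \int[m1]_(x in snd @^-1` A) (f x)%:E +
                      \int[m2]_(x in snd @^-1` (~` A)) (f x)%:E)%E.
Proof. by move=> mf i1 i2; rewrite (integral_comb _ _ _ _ mf i1 i2).2 !mul1e. Qed.

Lemma glued_plan : plan m1 -> plan m2 -> plan glued.
Proof.
move=> p1 p2 B mB; rewrite combE !mul1e.
have mBA := measurableI _ _ mB mA; have mBA' := measurableI _ _ mB (measurableC mA).
have -> : m1 (snd @^-1` B `&` snd @^-1` A) = nu (B `&` A) := p1 _ mBA.
have -> : m2 (snd @^-1` B `&` snd @^-1` (~` A)) = nu (B `&` ~` A) := p2 _ mBA'.
rewrite -measureU//; first by rewrite -setIUr setUv setIT.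
by rewrite setIACA setICr setI0.
Qed.

End glue.

Lemma mix_plan (m1 m2 : {measure set Z -> \bar R}) (a b : {nonneg R}) :
  a%:num + b%:num = 1 -> plan m1 -> plan m2 ->
  plan (comb a b m1 m2 measurableT measurableT).
Proof.
move=> ab p1 p2 B mB; rewrite combE !setIT p1// p2//.
by rewrite -ge0_muleDl// -EFinD ab mul1e.
Qed.

(** The weights 2^-(n+1) sum to one, which preserves the second marginal. *)
Lemma series_plan (m : nat -> {measure set Z -> \bar R}) :
  (forall n, plan (m n)) ->
  exists m' : {measure set Z -> \bar R}, plan m' /\
    forall g : Z -> \bar R, measurable_fun setT g -> (forall x, 0 <= g x)%E ->
    (\int[m']_z g z =
     \sum_(0 <= n <oo) ((1 / (2 ^ (n + 1))%:R : R)%:E * \int[m n]_z g z))%E.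
Proof.
move=> pm.
have h0 n : 0 <= 1 / (2 ^ (n + 1))%:R :> R by rewrite divr_ge0.
exists (mseries (fun n => mscale (NngNum (h0 n)) (m n)) 0); split => [A mA|g mg g0].
  rewrite /= /mseries /mscale /= (eq_eseriesr (g := fun n =>
    (fine (nu A))%:E * (1 / (2 ^ (n + 1))%:R)%:E)%E); last first.
    by move=> n _; rewrite fineK ?fin_num_measure// [RHS]muleC -(pm n A mA).
  rewrite nneseriesZl => [|n _]; last by rewrite lee_fin.
  rewrite (cvg_lim _ (@cvg_geometric_eseries_half R 1 0))//.
  by rewrite expr0 divr1 mule1 fineK// fin_num_measure.
rewrite ge0_integral_measure_series//; apply: eq_eseriesr => n _.
by rewrite ge0_integral_mscale.
Qed.

End plans.

(** * Exchanging supremum and integral *)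

Section interchange.
Context (R : realType) (X : pseudoPMetricType R) (nu : probability (borel X) R).
Local Notation Z := (borel (X * X)).

Definition sup_fst (f : X -> X -> R) (z : X) : \bar R :=
  ereal_sup (range (fun xi : X => (f xi z)%:E)).

Lemma sup_fst_ge f xi z : ((f xi z)%:E <= sup_fst f z)%E.
Proof. by apply: ereal_sup_ubound; exists xi. Qed.

Lemma lt_sup_fst f z (a : R) : (a%:E < sup_fst f z)%E -> exists xi, a < f xi z.
Proof. by move=> /ereal_sup_gt[_ [xi _ <-]]; rewrite lte_fin; exists xi. Qed.

Lemma sup_fst_measurable f : (forall xi a, open [set z | a < f xi z]) ->
  measurable_fun [set: borel X] (sup_fst f).
Proof.
move=> fo; apply: emeasurable_fun_g_sigma => a.
rewrite (_ : [set _ | _] = \bigcup_xi [set z | a < f xi z]).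
  by apply: bigcup_open => xi _; exact: fo.
apply/seteqP; split => z /=; first by move=> /lt_sup_fst[xi h]; exists xi.
by move=> [xi _ /= h]; apply: lt_le_trans (sup_fst_ge f xi z); rewrite lte_fin.
Qed.

Lemma sup_fst_neg_fin f z : (sup_fst f)^\-%E z \is a fin_num.
Proof.
rewrite ge0_fin_numE// funenegE gt_max ltry andbT.
have := sup_fst_ge f point z; case: sup_fst => //= r _.
by rewrite ltry.
Qed.

(** The weight [w] dominates [f], so that a plan of finite weight has a finite gain on every piece
    and gains of glued pieces can be added. *)
Context (f w : X -> X -> R) (C : R).
Hypotheses (mf : measurable_fun [set: Z] (fun z : Z => f z.1 z.2))
  (mw : measurable_fun [set: Z] (fun z : Z => w z.1 z.2))
  (C0 : 0 <= C) (w0 : forall x z, 0 <= w x z)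
  (fw : forall x z, `|f x z| <= C * w x z)
  (fo : forall xi a, open [set z | a < f xi z]).
Let phi := sup_fst f.

Let mphi : measurable_fun [set: borel X] phi := sup_fst_measurable fo.
Let mW : measurable_fun [set: Z] (fun z : Z => (w z.1 z.2)%:E).
Proof. exact/measurable_EFinP. Qed.

Let integrable_f (m : {measure set Z -> \bar R}) (D : set Z) : measurable D ->
  (\int[m]_(z in D) (w z.1 z.2)%:E < +oo)%E ->
  m.-integrable D (EFin \o (fun z : Z => f z.1 z.2)).
Proof.
move=> mD h; apply/integrableP; split.
  by apply: measurable_funTS; exact/measurable_EFinP.
apply: (@le_lt_trans _ _ (C%:E * \int[m]_(z in D) (w z.1 z.2)%:E)%E); last first.
  by apply: lte_mul_pinfty.
rewrite -ge0_integralZl_EFin//; last first.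
- exact: measurable_funTS.
- by move=> z _; rewrite lee_fin.
apply: ge0_le_integral => //.
- apply: measurableT_comp => //; apply: measurable_funTS; exact/measurable_EFinP.
- apply: measurable_funeM; exact: measurable_funTS.
- by move=> z _; rewrite /= -EFinM lee_fin.
Qed.

Let neg_finite (m : {measure set Z -> \bar R}) : plan nu m ->
  (\int[m]_z (w z.1 z.2)%:E < +oo)%E -> (\int[nu]_z phi^\- z < +oo)%E.
Proof.
move=> pm h.
rewrite -(plan_integral_snd pm (D := setT))//; last exact: measurable_funeneg.
have /integrableP[_] := integrable_f measurableT h; apply: le_lt_trans.
rewrite preimage_setT; apply: ge0_le_integral => //.
- exact: (measurableT_comp (measurable_funeneg mphi) (@measurable_snd_borel R X)).
- by apply: measurableT_comp => //; exact/measurable_EFinP.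
- move=> z _; rewrite funenegE ge_max abse_ge0 andbT.
  apply: (@le_trans _ _ (- (f z.1 z.2)%:E)%E).
    by rewrite leeN2; exact: sup_fst_ge.
  by rewrite -EFinN lee_fin -normrN ler_norm.
Qed.

(** The graph of a selection T above [h] is used on {w (T z) z <= k} and [m0] elsewhere, with k
    large. The error (C + 2) e consists of e for the gap between [h] and the truncated phi, e for
    the part of [h] outside the set, and C e for the gain of [m0] there. *)
Let integral_trunc (m0 : {measure set Z -> \bar R}) (b : R) (N : nat) (e : R) :
  plan nu m0 -> (\int[m0]_z (w z.1 z.2)%:E < +oo)%E ->
  (forall m, plan nu m -> (\int[m]_z (w z.1 z.2)%:E < +oo)%E ->
    (\int[m]_z (f z.1 z.2)%:E <= b%:E)%E) -> 0 < e ->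
  (\int[nu]_z mine (phi^\+ z) N%:R%:E <=
   (b + (C + 2) * e)%:E + \int[nu]_z phi^\- z)%E.
Proof.
move=> p0 i0 bd e0.
have fineE (g : X -> \bar R) : (forall z, g z \is a fin_num) ->
    measurable_fun [set: borel X] g -> measurable_fun [set: borel X] (fine \o g).
  by move=> _ mg; exact: measurableT_comp.
have ptrunc z : mine (phi^\+ z)%E N%:R%:E \is a fin_num.
  rewrite ge0_fin_numE; first by rewrite gt_min ltry orbT.
  by rewrite le_min funepos_ge0 lee_fin ler0n.
have ntrunc z : phi^\-%E z \is a fin_num by exact: sup_fst_neg_fin.
pose hp z := fine (mine (phi^\+ z)%E N%:R%:E); pose hm z := fine (phi^\-%E z).
have mhp : measurable_fun [set: borel X] hp.
  by apply: fineE => //; apply: measurable_mine => //; exact: measurable_funepos.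
have mhm : measurable_fun [set: borel X] hm.
  by apply: fineE => //; exact: measurable_funeneg.
have hpE z : (hp z)%:E = mine (phi^\+ z)%E N%:R%:E by rewrite fineK.
have hmE z : (hm z)%:E = phi^\-%E z by rewrite fineK.
have hp0 z : 0 <= hp z <= N%:R.
  by rewrite -!lee_fin hpE le_min funepos_ge0 lee_fin ler0n ge_min lexx orbT.
have hm0 z : 0 <= hm z by rewrite -lee_fin hmE funeneg_ge0.
(* Truncating at N makes [h] real and integrable, and strictly below phi even where phi is +oo. *)
pose h z := hp z - hm z - e.
have mh : measurable_fun [set: borel X] h.
  by apply: measurable_funB => //; exact: measurable_funB.
have hphi z : exists xi, h z < f xi z.
  apply: lt_sup_fst; have := sup_fst_ge f point z; rewrite -/(phi z).
  case E : (phi z) => [r| |//] _; rewrite ?ltry//.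
  rewrite /h !EFinB hpE hmE funeposE funenegE E.
  rewrite -!(EFin_max, EFin_min, EFinN, EFinD) lte_fin.
  have : Num.min (Num.max r 0) N%:R <= Num.max r 0 by rewrite ge_min lexx.
  case: (lerP r 0) => r0; case: (lerP (- r) 0) => r1; lra.
have [T [mT hT]] := measurable_selection fo mh hphi.
have mwT : measurable_fun [set: borel X] (fun z : borel X => w (T z) z).
  exact: (measurableT_comp mw mT).
pose A (k : nat) : set (borel X) := [set z | w (T z) z <= k%:R].
have mA k : measurable (A k).
  rewrite -[X in measurable X]setTI (_ : A k = (fun z => w (T z) z) @^-1` `]-oo, k%:R]%classic).
    exact: mwT.
  by apply/seteqP; split => z /=; rewrite in_itv.
have nA : {homo A : n k / (n <= k)%N >-> n `<=` k}.
  by move=> n k nk z /= /le_trans; apply; rewrite ler_nat.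
have UA : \bigcup_k A k = setT.
  apply/seteqP; split => // z _; exists (Num.truncn (w (T z) z)).+1 => //=.
  exact/ltW/truncnS_gt.
have Ihm : (\int[nu]_z (hm z)%:E < +oo)%E.
  by under eq_integral do rewrite hmE; exact: neg_finite p0 i0.
have ihm : nu.-integrable setT (EFin \o hm).
  apply/integrableP; split; first exact/measurable_EFinP.
  by under eq_integral do rewrite /= ger0_norm//.
have bnd_int (g : X -> R) (M : R) : measurable_fun [set: borel X] g ->
    (forall z, `|g z| <= M) -> nu.-integrable setT (EFin \o g).
  move=> mg gM; apply: (@le_integrable _ _ _ nu setT measurableT _ (EFin \o cst M)).
  - exact/measurable_EFinP.
  - move=> z _ /=; rewrite lee_fin; apply: le_trans (gM z) (ler_norm _).
  - by apply: finite_measure_integrable_cst.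
have ihp : nu.-integrable setT (EFin \o hp).
  by apply: (bnd_int _ N%:R) => // z; rewrite ger0_norm; case/andP: (hp0 z).
have icst : nu.-integrable setT (EFin \o cst e).
  by apply: (bnd_int _ e) => // z; rewrite ger0_norm// ltW.
have ih : nu.-integrable setT (EFin \o h).
  have := integrableB measurableT (integrableB measurableT ihp ihm) icst.
  by apply: eq_integrable.
have Ih : (\int[nu]_z (h z)%:E = \int[nu]_z (hp z)%:E - \int[nu]_z (hm z)%:E - e%:E)%E.
  rewrite [LHS](_ : _ = \int[nu]_z ((fun z => (hp z)%:E - (hm z)%:E) \- cst e%:E) z)%E//.
  rewrite integralB//; last exact: integrableB.
  rewrite integralB// integral_cst// [X in (_ * X)%E](_ : _ = 1%E) ?mule1//.
  exact: probability_setT.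
have iah : (\int[nu]_z `|(h z)%:E| < +oo)%E by have /integrableP[] := ih.
have t1 := ge0_integral_tail (e := e) mW (fun z => _) i0
  (fun n => measurable_snd_preimage (mA n)).
have {}t1 : \forall n \near \oo,
    (\int[m0]_(z in ~` (snd @^-1` A n)) (w z.1 z.2)%:E < e%:E)%E.
  apply: t1 => //; first by move=> z; rewrite lee_fin.
    by move=> n k nk z; exact: nA.
  by rewrite -preimage_bigcup UA.
have t2 : \forall n \near \oo, (\int[nu]_(z in ~` A n) `|(h z)%:E| < e%:E)%E.
  apply: ge0_integral_tail => //.
  by apply: measurableT_comp => //; exact/measurable_EFinP.
have [k [tk1 tk2]] : exists k,
    (\int[m0]_(z in ~` (snd @^-1` A k)) (w z.1 z.2)%:E < e%:E)%E /\
    (\int[nu]_(z in ~` A k) `|(h z)%:E| < e%:E)%E.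
  have [k _ /(_ k (leqnn _)) /= [? ?]] := filterI t1 t2.
  by exists k.
pose D1 := measurable_snd_preimage (mA k).
pose D2 := measurable_snd_preimage (measurableC (mA k)).
pose m := glued (graph_plan nu mT) m0 (mA k).
have pm : plan nu m.
  by apply: glued_plan => //; exact: graph_plan_plan.
have Aint : (\int[graph_plan nu mT]_(z in snd @^-1` A k) (w z.1 z.2)%:E < +oo)%E.
  rewrite ge0_integral_graph_plan//=; last by move=> z; rewrite lee_fin.
  apply: (@le_lt_trans _ _ (\int[nu]_(z in A k) (cst k%:R%:E) z)%E).
    apply: (ge0_le_integral nu (mA k)) => // [z _|].
      by rewrite lee_fin.
    by apply: measurable_funTS; exact/measurable_EFinP.
  rewrite integral_cst//; apply: lte_mul_pinfty => //.
  by rewrite -ge0_fin_numE// fin_num_measure.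
have Bint : (\int[m0]_(z in snd @^-1` ~` A k) (w z.1 z.2)%:E < +oo)%E.
  by apply: lt_trans tk1 _; rewrite ltry.
have im : (\int[m]_z (w z.1 z.2)%:E < +oo)%E.
  rewrite ge0_integral_glued//; last by move=> z; rewrite lee_fin.
  exact: lte_add_pinfty.
have := bd m pm im.
have if1 := integrable_f D1 Aint; have if2 := integrable_f D2 Bint.
rewrite (integral_glued (mA k) mf if1 if2).
have fin1 := integrable_fin_num D1 if1; have fin2 := integrable_fin_num D2 if2.
have ihA : nu.-integrable (A k) (EFin \o h).
  exact: integrableS ih.
have ihC : nu.-integrable (~` A k) (EFin \o h).
  by apply: integrableS ih => //; exact: measurableC.
have ge1 : (\int[nu]_(z in A k) (h z)%:E <=
    \int[graph_plan nu mT]_(z in snd @^-1` A k) (f z.1 z.2)%:E)%E.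
  rewrite integral_graph_plan//=; last exact/measurable_EFinP.
  apply: le_integral => //; last first.
  - by move=> z _; rewrite lee_fin ltW.
  - have /integrableP[_] := if1.
    rewrite ge0_integral_graph_plan//=; last first.
      by apply/measurable_EFinP; exact: measurableT_comp.
    move=> fT; apply/integrableP; split => //.
    apply: measurable_funTS; apply/measurable_EFinP.
    exact: (measurableT_comp mf mT).
have ge2 : (- (C * e)%:E <= \int[m0]_(z in snd @^-1` ~` A k) (f z.1 z.2)%:E)%E.
  have : (`|\int[m0]_(z in snd @^-1` ~` A k) (f z.1 z.2)%:E| <= (C * e)%:E)%E.
    apply: le_trans (le_abse_integral _ _ _) _ => //.
      by apply: measurable_funTS; exact/measurable_EFinP.
    apply: (@le_trans _ _ (C%:E * \int[m0]_(z in snd @^-1` ~` A k) (w z.1 z.2)%:E)%E).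
      rewrite -ge0_integralZl_EFin//; last first.
      - exact: measurable_funTS.
      - by move=> z _; rewrite lee_fin.
      apply: ge0_le_integral => //.
      - by apply: measurableT_comp => //; apply: measurable_funTS; exact/measurable_EFinP.
      - by apply: measurable_funeM; exact: measurable_funTS.
      - by move=> z _; rewrite /= -EFinM lee_fin.
    by rewrite EFinM; apply: lee_wpmul2l; rewrite ?lee_fin// ltW.
  by rewrite -(fineK fin2) -EFinN /= !lee_fin ler_norml => /andP[].
have splitA : (\int[nu]_z (h z)%:E = \int[nu]_(z in A k) (h z)%:E +
    \int[nu]_(z in ~` A k) (h z)%:E)%E.
  rewrite -(setUv (A k)) integral_setU//; [exact: measurableC| |].
    by rewrite setUv; exact/measurable_EFinP.
  by apply/disj_set2P; rewrite setICr.
have leC : (\int[nu]_(z in ~` A k) (h z)%:E <= e%:E)%E.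
  apply: le_trans (ltW tk2); apply: le_trans (lee_abs _) _.
  apply: le_abse_integral; first exact: measurableC.
  by apply: measurable_funTS; exact/measurable_EFinP.
have -> : (\int[nu]_z mine (phi^\+ z) N%:R%:E = \int[nu]_z (hp z)%:E)%E.
  by apply: eq_integral => z _; rewrite hpE.
have -> : (\int[nu]_z phi^\- z = \int[nu]_z (hm z)%:E)%E.
  by apply: eq_integral => z _; rewrite hmE.
have finp := integrable_fin_num measurableT ihp.
have finm := integrable_fin_num measurableT ihm.
have finA := integrable_fin_num (mA k) ihA.
have finC := integrable_fin_num (measurableC (mA k)) ihC.
move: Ih; rewrite splitA => Ih; move: fin1 fin2 finp finm finA finC ge1 ge2 leC Ih => /=.
move=> /fineK<- /fineK<- /fineK<- /fineK<- /fineK<- /fineK<-.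
rewrite -!(EFinN, EFinD) !lee_fin => ge1 ge2 leC [Ih]; lra.
Qed.

(* Selecting a near-maximiser on the sets where it costs little and keeping the
   given plan elsewhere. *)
Lemma dintegral_sup_le (m0 : {measure set Z -> \bar R}) (b : R) :
  plan nu m0 -> (\int[m0]_z (w z.1 z.2)%:E < +oo)%E ->
  (forall m, plan nu m -> (\int[m]_z (w z.1 z.2)%:E < +oo)%E ->
    (\int[m]_z (f z.1 z.2)%:E <= b%:E)%E) ->
  (dintegral nu phi <= b%:E)%E.
Proof.
move=> p0 i0 bd; have In := neg_finite p0 i0.
have Inf : (\int[nu]_z phi^\- z)%E \is a fin_num.
  by rewrite ge0_fin_numE//; exact: integral_ge0.
have Ip e : 0 < e -> (\int[nu]_z phi^\+ z <=
    (b + (C + 2) * e)%:E + \int[nu]_z phi^\- z)%E.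
  move=> e0; pose g (N : nat) z := mine (phi^\+ z)%E N%:R%:E.
  have cg z : g N z @[N --> \oo] --> (phi^\+ z)%E.
    rewrite /g; have : (0 <= phi^\+ z)%E by [].
    case: (phi^\+ z)%E => [r| |//] _.
      apply: cvg_near_cst; near=> N.
      apply: min_idPl; rewrite lee_fin; near: N.
      exists (Num.truncn r).+1 => // N /= hN.
      by apply: le_trans (ltW (truncnS_gt r)) _; rewrite ler_nat.
    rewrite (_ : (fun N => _) = (fun N => N%:R%:E)); last first.
      by apply/funext => N; apply/min_idPr; rewrite leey.
    exact/cvgenyP.
  have mg N : measurable_fun [set: borel X] (g N).
    by apply: measurable_mine => //; exact: measurable_funepos.
  have g0 N z : (0 <= g N z)%E by rewrite le_min funepos_ge0 lee_fin ler0n.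
  have ndg z : {homo g ^~ z : n k / (n <= k)%N >-> (n <= k)%E}.
    by move=> n k nk; rewrite /g le_min2// lee_fin ler_nat.
  have -> : (\int[nu]_z phi^\+ z = \int[nu]_z limn (g ^~ z))%E.
    by apply: eq_integral => z _; apply/esym/cvg_lim.
  rewrite monotone_convergence//; apply: lime_le.
    apply: ereal_nondecreasing_is_cvgn => n k nk.
    by apply: ge0_le_integral => // z _; exact: ndg.
  by apply: nearW => N; exact: (integral_trunc N p0 i0 bd e0).
have {}Ip : (\int[nu]_z phi^\+ z <= b%:E + \int[nu]_z phi^\- z)%E.
  apply/lee_addgt0Pr => e e0.
  have C2 : 0 < C + 2 by rewrite ltr_wpDl.
  have := Ip (e / (C + 2)) (divr_gt0 e0 C2).
  by rewrite [_ * (e / _)]mulrC divfK ?gt_eqF// EFinD addeAC.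
have I0 : (0 <= \int[nu]_z phi^\+ z)%E by exact: integral_ge0.
rewrite /dintegral; move: Ip Inf I0.
move=> /[swap] /fineK<-; case: (\int[nu]_z phi^\+ z)%E => [r| |]//= Ip _.
by move: Ip; rewrite -EFinD /= !lee_fin lerBlDr.
Unshelve. all: by end_near. Qed.

End interchange.

(** * Feasible plans and weak duality *)

Lemma ge0_integral_marginal (R : realType) (d1 d2 : measure_display)
    (S : measurableType d1) (T : measurableType d2) (h : S -> T)
    (m : {measure set S -> \bar R}) (mu : {measure set T -> \bar R})
    (g : T -> \bar R) : measurable_fun setT h ->
  (forall A, measurable A -> m (h @^-1` A) = mu A) ->
  measurable_fun setT g -> (forall x, 0 <= g x)%E ->
  (\int[m]_z g (h z) = \int[mu]_x g x)%E.
Proof.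
move=> mh hm mg g0.
have := @ge0_integral_pushforward _ _ _ _ _ h mh m setT g measurableT mg.
rewrite preimage_setT => <-; last by move=> y _.
by apply: eq_measure_integral => A mA _; exact: hm.
Qed.

Lemma integral_marginal (R : realType) (d1 d2 : measure_display)
    (S : measurableType d1) (T : measurableType d2) (h : S -> T)
    (m : {measure set S -> \bar R}) (mu : {measure set T -> \bar R})
    (g : T -> \bar R) : measurable_fun setT h ->
  (forall A, measurable A -> m (h @^-1` A) = mu A) ->
  measurable_fun setT g -> (\int[m]_z g (h z) = \int[mu]_x g x)%E.
Proof.
move=> mh hm mg; rewrite integralE [RHS]integralE.
rewrite -(ge0_integral_marginal (g := g^\+%E) mh hm)//; last exact: measurable_funepos.
rewrite -(ge0_integral_marginal (g := g^\-%E) mh hm)//; last exact: measurable_funeneg.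
congr (_ - _)%E; apply: eq_integral => x _.
  by rewrite !funeposE.
by rewrite !funenegE.
Qed.

Section probability_of_measure.
Context (R : realType) (dsp : measure_display) (T : measurableType dsp)
  (m : {measure set T -> \bar R}) (m1 : m setT = 1%E).

(** The vacuous [let] keeps the proof of unit mass as an argument of the constant, from which the
    probability structure is then inferred. *)
Definition probability_of : set T -> \bar R := let _ := m1 in m.

HB.instance Definition _ := isMeasure.Build _ _ _ probability_of
  (measure0 m) (measure_ge0 m) (@measure_semi_sigma_additive _ _ _ m).

HB.instance Definition _ := Measure_isProbability.Build _ _ _ probability_of m1.

End probability_of_measure.

(** Moving the negative parts across avoids subtraction, but the first inequality is void when N =
    +oo. The second one settles P = +oo: it forces P' = +oo, and the dual addition then makes the
    right-hand side +oo. *)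
Lemma dsube_le_add (R : realType) (P N P' N' : \bar R) (B : R) :
  (0 <= P)%E -> (0 <= N)%E -> (0 <= P')%E -> (0 <= N')%E ->
  (P + N' <= P' + N + B%:E)%E -> (P <= P' + B%:E)%E ->
  ((P - N)%dE <= B%:E + (P' - N')%dE)%E.
Proof.
move: P N P' N' => [P| |] [N| |] [P'| |] [N'| |] //= _ _ _ _.
all: rewrite -?EFinD ?lee_fin ?leNye ?leey //= => h1 h2; rewrite ?lee_fin ?leNye ?leey //=.
by lra.
Qed.

Section feasible.
Context (R : realType) (K : nat) (Xi : set 'cV[R]_K) (d : Xi -> Xi -> R)
  (hd : is_metric d) (x0 : Xi).
Local Notation X := (metric_sub hd x0).
Local Notation Z := (borel (X * X)).
Context (p R0 : R) (m0 : 'cV[R]_K) (Sigma0 : 'M[R]_K)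
  (nu : probability (borel X) R).
Hypotheses (p1 : 1 <= p) (R00 : 0 < R0) (sym0 : Sigma0^T = Sigma0)
  (nu2 : has_second_moment m0 nu).

Lemma dist_ge0 (x y : X) : 0 <= d x y.
Proof. exact: (@mdist_ge0 R X). Qed.

Lemma open_dist_lt (xi : X) (b : R) : open [set z : X | d xi z `^ p < b].
Proof.
have p0 : 0 < p by exact: lt_le_trans p1.
have [b0|b0] := leP b 0.
  rewrite (_ : [set _ | _] = set0); first exact: open0.
  by apply/seteqP; split => z //=; rewrite ltNge (le_trans b0)// powR_ge0.
rewrite (_ : [set _ | _] = [set z : X | d xi z < b `^ p^-1]).
  rewrite openE => z /= xiz; apply/nbhs_ballP.
  exists (b `^ p^-1 - d xi z); first by rewrite /= subr_gt0.
  move=> y zy; have {}zy : d z y < b `^ p^-1 - d xi z by exact: zy.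
  by have := dist_tri hd z xi y; rewrite /=; lra.
have pK t : 0 <= t -> (t `^ p) `^ p^-1 = t.
  by move=> t0; rewrite -powRrM mulfV ?gt_eqF// powRr1.
have pK' : (b `^ p^-1) `^ p = b by rewrite -powRrM mulVf ?gt_eqF// powRr1// ltW.
apply/seteqP; split => z /= h.
  by rewrite -(pK (d xi z)) ?dist_ge0// gt0_ltr_powR ?invr_gt0// nnegrE ?powR_ge0// ltW.
by rewrite -[ltRHS]pK' gt0_ltr_powR// nnegrE ?powR_ge0// dist_ge0.
Qed.

Lemma open_dist_gt (a : R) : open [set z : X * X | a < d z.1 z.2].
Proof.
rewrite openE => -[x y] /= axy; pose e := (d x y - a) / 2.
have e0 : 0 < e by rewrite divr_gt0// subr_gt0.
exists (ball x e, ball y e); first by split; exact: nbhsx_ballx.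
move=> [x' y'] /= [bx by_].
have hx : d x x' < e by exact: bx.
have hy : d y y' < e by exact: by_.
have t1 := dist_tri hd x' x y; have t2 := dist_tri hd y' x' y.
rewrite (dist_sym hd y' y) in t2; rewrite /e in hx hy; lra.
Qed.

Lemma measurable_cost : measurable_fun [set: Z] (fun z : Z => d z.1 z.2 `^ p).
Proof.
apply: (@measurableT_comp _ _ _ _ _ _ (fun t : R => t `^ p) _ (fun z : Z => d z.1 z.2)).
  exact: measurable_powR.
apply/measurable_EFinP; apply: (@emeasurable_fun_g_sigma R (X * X)%type) => a.
rewrite (_ : [set _ | _] = [set z : X * X | a < d z.1 z.2]); first exact: open_dist_gt.
by apply/seteqP; split => z /=; rewrite lte_fin.
Qed.

Local Notation out := (@outer R K Xi d hd x0 m0).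

Definition dev (x : X) : 'cV[R]_K := pos_of x - m0.

Lemma measurable_outer i j :
  measurable_fun [set: borel X] (fun x : borel X => out x i j).
Proof. by apply/measurable_EFinP; have /measurable_int := nu2 i j. Qed.

Lemma outerE x i j : out x i j = dev x i 0 * dev x j 0.
Proof. by rewrite /outer [LHS]mxE big_ord1 [X in _ * X]mxE. Qed.

Lemma qform_devE A x : qform A (dev x) = \sum_i \sum_j A i j * out x i j.
Proof.
rewrite qformE; apply: eq_bigr => i _; apply: eq_bigr => j _.
by rewrite outerE.
Qed.

Lemma measurable_qform_dev A :
  measurable_fun [set: borel X] (fun x : borel X => qform A (dev x)).
Proof.
under eq_fun do rewrite qform_devE.
apply: measurable_sum => i; apply: measurable_sum => j.
by apply: measurable_funM => //; exact: measurable_outer.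
Qed.

Lemma outer_le x i j : `|out x i j| <= qform 1%:M (dev x).
Proof.
have hi k : dev x k 0 ^+ 2 <= qform 1%:M (dev x).
  by rewrite qform1 (bigD1 k)//= lerDl; apply: sumr_ge0 => l _; exact: sqr_ge0.
by rewrite outerE ler_norml; apply/andP; split; have := hi i; have := hi j; nra.
Qed.

Definition moment (mu : {measure set borel X -> \bar R}) : 'M[R]_K :=
  \matrix_(i, j) fine (\int[mu]_x (out x i j)%:E).

Lemma moment_sym mu : (moment mu)^T = moment mu.
Proof.
apply/matrixP => i j; rewrite !mxE; congr fine; apply: eq_integral => x _.
by congr EFin; rewrite !outerE mulrC.
Qed.

Section moments.
Context (mu : {measure set borel X -> \bar R}).
Hypothesis mu2 : (\int[mu]_x (qform 1%:M (dev x))%:E < +oo)%E.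

Lemma integrable_outer i j : mu.-integrable setT (fun x => (out x i j)%:E).
Proof.
apply/integrableP; split; first by apply/measurable_EFinP; exact: measurable_outer.
apply: le_lt_trans mu2; apply: ge0_le_integral => //.
- by apply: measurableT_comp => //; apply/measurable_EFinP; exact: measurable_outer.
- by apply/measurable_EFinP; exact: measurable_qform_dev.
- by move=> x _; rewrite /= lee_fin outer_le.
Qed.

Lemma integral_qform_dev A :
  (\int[mu]_x (qform A (dev x))%:E = (\tr (A^T *m moment mu))%:E)%E.
Proof.
rewrite mxtrace_mulE.
under eq_integral do rewrite qform_devE -sumEFin.
rewrite integral_sum//=; last first.
  move=> i; rewrite (_ : (fun x => _) = (fun x => \sum_j (A i j * out x i j)%:E)%E).
    2: by apply/funext => x; rewrite sumEFin.
  apply: integrable_sum => // j _.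
  by under eq_fun do rewrite EFinM; apply: integrableZl => //; exact: integrable_outer.
rewrite -sumEFin; apply: eq_bigr => i _.
under eq_integral do rewrite -sumEFin.
rewrite integral_sum//=; last first.
  by move=> j; under eq_fun do rewrite EFinM; apply: integrableZl => //; exact: integrable_outer.
rewrite -sumEFin; apply: eq_bigr => j _.
under eq_integral do rewrite EFinM.
rewrite integralZl//; last exact: integrable_outer.
by rewrite mxE EFinM fineK//; apply: integrable_fin_num => //; exact: integrable_outer.
Qed.

Lemma qform_moment u :
  (\int[mu]_x (qform (u *m u^T) (dev x))%:E = (qform (moment mu) u)%:E)%E.
Proof.
rewrite integral_qform_dev; congr EFin.
by rewrite -mxtrace_outer trmx_mul trmxK moment_sym mxtrace_mulC.
Qed.

End moments.

Lemma probability_second_moment (mu : probability (borel X) R) :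
  has_second_moment m0 mu -> (\int[mu]_x (qform 1%:M (dev x))%:E < +oo)%E.
Proof.
move=> mu2; rewrite -ge0_fin_numE; last first.
  by apply: integral_ge0 => x _; rewrite lee_fin qform1_ge0.
have -> : (fun x : borel X => (qform 1%:M (dev x))%:E) =
    (fun x => \sum_i (out x i i)%:E)%E.
  apply/funext => x; rewrite sumEFin qform1; congr EFin.
  by apply: eq_bigr => i _; rewrite outerE expr2.
by apply: integrable_fin_num => //; apply: integrable_sum => // i _; exact: mu2.
Qed.

Definition marg (m : {measure set Z -> \bar R}) : {measure set borel X -> \bar R} :=
  measure_function_pushforward__canonical__measure_function_Measure m
    (@measurable_fst_borel R X).

Lemma ge0_integral_marg m (g : borel X -> \bar R) : measurable_fun setT g ->
  (forall x, 0 <= g x)%E -> (\int[marg m]_x g x = \int[m]_z g z.1)%E.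
Proof.
move=> mg g0; apply/esym/ge0_integral_marginal => //.
exact: measurable_fst_borel.
Qed.

Lemma integral_marg m (g : borel X -> \bar R) : measurable_fun setT g ->
  (\int[marg m]_x g x = \int[m]_z g z.1)%E.
Proof.
by move=> mg; apply/esym/integral_marginal => //; exact: measurable_fst_borel.
Qed.

(** The matrix inequality is tested on the nonnegative functions (u^T (xi - m0))^2, so it is
    meaningful before the second moment is known to be finite, and implies that finiteness. *)
Definition feasible (m : {measure set Z -> \bar R}) :=
  [/\ plan nu m, (\int[m]_z (d z.1 z.2 `^ p)%:E <= (R0 `^ p)%:E)%E &
      forall u, (\int[marg m]_x (qform (u *m u^T) (dev x))%:E <=
                 (qform Sigma0 u)%:E)%E].

Lemma qform_outer_ge0 (u v : 'cV[R]_K) : 0 <= qform (u *m u^T) v.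
Proof. by rewrite qform_outer sqr_ge0. Qed.

Lemma feasible_second_moment m : feasible m ->
  (\int[marg m]_x (qform 1%:M (dev x))%:E < +oo)%E.
Proof.
move=> [_ _ fm].
have -> : (fun x : borel X => (qform 1%:M (dev x))%:E) =
    (fun x => \sum_i (qform ((delta_mx i 0 : 'cV_K) *m (delta_mx i 0 : 'cV_K)^T) (dev x))%:E)%E.
  apply/funext => x; rewrite sumEFin qform1; congr EFin; apply: eq_bigr => i _.
  by rewrite qform_outer -colE !mxE.
rewrite ge0_integral_sum//; last 2 first.
- by move=> i; apply/measurable_EFinP; exact: measurable_qform_dev.
- by move=> i x _; rewrite lee_fin qform_outer_ge0.
apply: lte_sum_pinfty => i _.
by apply: le_lt_trans (fm _) _; rewrite ltry.
Qed.

Lemma plan_setT m : plan nu m -> m setT = 1%E.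
Proof. by move=> /(_ setT measurableT); rewrite preimage_setT => ->; exact: probability_setT. Qed.

(** The plan itself couples its first marginal with [nu], so its cost bounds the Wasserstein
    distance. *)
Lemma primal_ge (Psi : X -> R) m : feasible m ->
  ((\int[marg m]_x (EFin \o Psi)^\+ x)%E - (\int[marg m]_x (EFin \o Psi)^\- x)%E <=
   primal_value p R0 m0 Sigma0 nu Psi)%dE.
Proof.
move=> fm; have [pm cm Mm] := fm; have m1 := plan_setT pm.
have mm1 : marg m setT = 1%E by rewrite -m1.
have m2 := feasible_second_moment fm.
have p0 : 0 < p by exact: lt_le_trans p1.
pose g : probability Z R := probability_of m1.
pose mu : probability (borel X) R := probability_of mm1.
apply: ereal_sup_ubound; exists mu => //; split.
- rewrite /wasserstein.
  have -> : R0%:E = ((R0 `^ p)%:E `^ p^-1)%E.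
    by rewrite poweR_EFin -powRrM mulfV ?gt_eqF// powRr1// ltW.
  apply: gt0_ler_poweR; first by rewrite invr_ge0 ltW.
  + rewrite in_itv /= leey andbT; apply: le_ereal_inf_tmp => _ [g' _ <-].
    by apply: integral_ge0 => z _; rewrite lee_fin powR_ge0.
  + by rewrite in_itv /= leey andbT lee_fin powR_ge0.
  + apply: le_trans cm; apply: ereal_inf_lbound; exists g => // A mA.
    by split => //; exact: pm.
- by move=> i j; exact: integrable_outer.
- have -> : second_moment m0 mu = moment (marg m).
    by apply/matrixP => i j; rewrite !mxE.
  split=> [|u]; first by rewrite linearB /= sym0 moment_sym.
  rewrite -/(qform _ _) qformD qformN subr_ge0 -lee_fin.
  by rewrite -qform_moment.
Qed.

Definition lagr (Psi : X -> R) (lambda : R) (Lambda : 'M[R]_K) (x z : X) : R :=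
  Psi x - lambda * d x z `^ p - qform Lambda (dev x).

Lemma lagr_open Psi lambda Lambda xi a : 0 <= lambda ->
  open [set z | a < lagr Psi lambda Lambda xi z].
Proof.
rewrite /lagr le_eqVlt => /orP[/eqP<-|l0].
  have [h|h] := pselect (a < Psi xi - qform Lambda (dev xi)).
    rewrite (_ : [set _ | _] = setT); first exact: openT.
    by apply/seteqP; split => // z _ /=; rewrite mul0r subr0.
  rewrite (_ : [set _ | _] = set0); first exact: open0.
  by apply/seteqP; split => // z /=; rewrite mul0r subr0.
rewrite (_ : [set _ | _] =
    [set z : X | d xi z `^ p < (Psi xi - qform Lambda (dev xi) - a) / lambda]).
  exact: open_dist_lt.
apply/seteqP; split => z /=; rewrite ltr_pdivlMr// => h; lra.
Qed.

Section dual.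
Context (Psi : X -> R) (mPsi : measurable_fun [set: borel X] Psi).
Context (lambda : R) (Lambda : 'M[R]_K) (l0 : 0 <= lambda) (L0 : psdmx Lambda).

Local Notation phi := (dual_integrand p m0 Psi lambda Lambda).
Local Notation psi := (EFin \o Psi).

Lemma dual_integrandE : phi = sup_fst (lagr Psi lambda Lambda).
Proof. by []. Qed.

Lemma measurable_dual_integrand : measurable_fun [set: borel X] phi.
Proof.
rewrite dual_integrandE; apply: sup_fst_measurable => xi a.
exact: lagr_open.
Qed.

(** All four integrals may be infinite. The pointwise inequality Psi <= phi + b is therefore
    integrated in two forms with nonnegative terms only, [key] and [key2], which [dsube_le_add]
    recombines. *)
Lemma plan_dual_le m B : plan nu m ->
  (\int[m]_z (lambda * d z.1 z.2 `^ p + qform Lambda (dev z.1))%:E <= B%:E)%E ->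
  ((\int[marg m]_x psi^\+ x - \int[marg m]_x psi^\- x)%dE <=
   B%:E + dintegral nu phi)%E.
Proof.
move=> pm hB; pose b (z : Z) := lambda * d z.1 z.2 `^ p + qform Lambda (dev z.1).
have b0 z : (0 <= (b z)%:E)%E.
  by rewrite lee_fin addr_ge0 ?mulr_ge0 ?powR_ge0//; case: L0 => _; apply.
have mb : measurable_fun [set: Z] (fun z => (b z)%:E).
  apply/measurable_EFinP; apply: measurable_funD.
    by apply: measurable_funM => //; exact: measurable_cost.
  exact: (measurableT_comp (measurable_qform_dev Lambda) (@measurable_fst_borel R X)).
have mp : measurable_fun [set: borel X] psi^\+%E.
  by apply: measurable_funepos; exact/measurable_EFinP.
have mn : measurable_fun [set: borel X] psi^\-%E.
  by apply: measurable_funeneg; exact/measurable_EFinP.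
have mphi := measurable_dual_integrand.
have mp' : measurable_fun [set: borel X] phi^\+%E by exact: measurable_funepos.
have mn' : measurable_fun [set: borel X] phi^\-%E by exact: measurable_funeneg.
have onfst (g : borel X -> \bar R) : measurable_fun setT g ->
    measurable_fun [set: Z] (fun z : Z => g z.1).
  by move=> mg; exact: (measurableT_comp mg (@measurable_fst_borel R X)).
have onsnd (g : borel X -> \bar R) : measurable_fun setT g ->
    measurable_fun [set: Z] (fun z : Z => g z.2).
  by move=> mg; exact: (measurableT_comp mg (@measurable_snd_borel R X)).
have sndE (g : borel X -> \bar R) : measurable_fun setT g ->
    (forall x, 0 <= g x)%E -> (\int[nu]_x g x = \int[m]_z g z.2)%E.
  move=> mg g0; apply/esym/ge0_integral_marginal => //.
  exact: measurable_snd_borel.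
have key (z : Z) : (psi^\+ z.1 + phi^\- z.2 <= phi^\+ z.2 + psi^\- z.1 + (b z)%:E)%E.
  have : ((Psi z.1 - b z)%:E <= phi z.2)%E.
    by have := sup_fst_ge (lagr Psi lambda Lambda) z.1 z.2; rewrite /lagr /b opprD addrA.
  rewrite !funeposE !funenegE /=; case: (phi z.2) => [t| |//] h.
    move: h; rewrite -!(EFin_max, EFinN, EFinD) !lee_fin => h.
    by case: (lerP (Psi z.1) 0) => ?; case: (lerP (- Psi z.1) 0) => ?;
      case: (lerP t 0) => ?; case: (lerP (- t) 0) => ?; lra.
  by rewrite (max_idPl (leey _)) -!EFin_max !addye ?leey.
have key2 (z : Z) : (psi^\+ z.1 <= phi^\+ z.2 + (b z)%:E)%E.
  have : ((Psi z.1 - b z)%:E <= phi z.2)%E.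
    by have := sup_fst_ge (lagr Psi lambda Lambda) z.1 z.2; rewrite /lagr /b opprD addrA.
  rewrite !funeposE /=; have := b0 z; rewrite lee_fin; case: (phi z.2) => [t| |//] b0z h.
    move: h; rewrite -!(EFin_max, EFinN, EFinD) !lee_fin => h.
    by case: (lerP (Psi z.1) 0) => ?; case: (lerP t 0) => ?; lra.
  by rewrite (max_idPl (leey _)) addye// leey.
have sub : (\int[m]_z (b z)%:E <= B%:E)%E by exact: hB.
apply: dsube_le_add; try by apply: integral_ge0.
- rewrite !ge0_integral_marg// !sndE//.
  apply: le_trans (leeD2l _ sub).
  rewrite -!ge0_integralD//; do ?[exact: onfst|exact: onsnd].
  + apply: ge0_le_integral => //.
    * by move=> z _; rewrite adde_ge0.
    * by apply: emeasurable_funD; [exact: onfst|exact: onsnd].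
    * by apply: emeasurable_funD => //; apply: emeasurable_funD; [exact: onsnd|exact: onfst].
  + by move=> z _; rewrite adde_ge0.
  + by apply: emeasurable_funD; [exact: onsnd|exact: onfst].
- rewrite !ge0_integral_marg// !sndE//.
  apply: le_trans (leeD2l _ sub).
  rewrite -!ge0_integralD//; do ?[exact: onfst|exact: onsnd].
  apply: ge0_le_integral => //; first exact: onfst.
  by apply: emeasurable_funD => //; exact: onsnd.
Qed.

End dual.


Section weak_duality.
Context (Psi : X -> R) (mPsi : measurable_fun [set: borel X] Psi).

Lemma weak_duality (lambda : R) (Lambda : 'M[R]_K) : 0 <= lambda -> psdmx Lambda ->
  (primal_value p R0 m0 Sigma0 nu Psi <=
   dual_objective p R0 m0 Sigma0 nu Psi lambda Lambda)%E.
Proof.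
move=> l0 L0; apply: ge_ereal_sup => _ [mu [Wmu mu2 Mmu] <-].
have p0 : 0 < p by exact: lt_le_trans p1.
set I := ereal_inf [set (\int[g]_z ((d z.1 z.2) `^ p)%:E)%E | g in coupling mu nu].
have I0 : (0 <= I)%E.
  apply: le_ereal_inf_tmp => _ [g' _ <-].
  by apply: integral_ge0 => z _; rewrite lee_fin powR_ge0.
have IR : (I <= (R0 `^ p)%:E)%E.
  have -> : I = ((I `^ p^-1) `^ p)%E by rewrite -poweRrM mulVf ?gt_eqF// poweRe1.
  rewrite -poweR_EFin; apply: gt0_ler_poweR => //; first exact: ltW.
  - by rewrite in_itv /= leey poweR_ge0.
  - by rewrite in_itv /= leey lee_fin ltW.
apply/lee_addgt0Pr => e e0.
have l1 : 0 < lambda + 1 by rewrite ltr_wpDl.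
(* A coupling within [dl] of the infimum replaces an optimal one; the added 1 covers lambda = 0 and
   still gives lambda [dl] <= e. *)
pose dl := e / (lambda + 1).
have dl0 : 0 < dl by exact: divr_gt0.
have [_ [g gc <-] hg] : exists2 y, [set (\int[g]_z ((d z.1 z.2) `^ p)%:E)%E |
    g in coupling mu nu] y & (y < (R0 `^ p + dl)%:E)%E.
  by apply: ereal_inf_lt; apply: le_lt_trans IR _; rewrite lte_fin ltrDl.
have pg : plan nu g by move=> A mA; exact: (gc A mA).2.
have fstE (h : borel X -> \bar R) : (\int[mu]_x h x = \int[marg g]_x h x)%E.
  by apply: eq_measure_integral => A mA _; apply/esym; exact: (gc A mA).1.
have mg2 : (\int[marg g]_x (qform 1%:M (dev x))%:E < +oo)%E.
  by rewrite -fstE; exact: probability_second_moment.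
have trle : \tr (Lambda^T *m moment (marg g)) <= \tr (Lambda^T *m Sigma0).
  rewrite -subr_ge0 -linearB -mulmxBr; apply: psdmx_mxtrace_ge0 => //.
  have -> // : moment (marg g) = second_moment m0 mu.
  by apply/matrixP => i j; rewrite !mxE; congr fine; rewrite -fstE.
have hB : (\int[g]_z (lambda * d z.1 z.2 `^ p + qform Lambda (dev z.1))%:E <=
    (lambda * (R0 `^ p + dl) + \tr (Lambda^T *m Sigma0))%:E)%E.
  under eq_integral do rewrite EFinD.
  have mq : measurable_fun [set: borel X] (fun x : borel X => (qform Lambda (dev x))%:E).
    by apply/measurable_EFinP; exact: measurable_qform_dev.
  rewrite ge0_integralD//=; last 4 first.
  - by move=> z _; rewrite lee_fin mulr_ge0 ?powR_ge0.
  - apply/measurable_EFinP; apply: measurable_funM => //; exact: measurable_cost.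
  - by move=> z _; rewrite lee_fin; case: L0 => _; apply.
  - exact: (measurableT_comp mq (@measurable_fst_borel R X)).
  rewrite EFinD; apply: leeD.
    under eq_integral do rewrite EFinM.
    rewrite ge0_integralZl_EFin//; last 2 first.
    - by move=> z _; rewrite lee_fin powR_ge0.
    - by apply/measurable_EFinP; exact: measurable_cost.
    by rewrite EFinM; apply: lee_wpmul2l; rewrite ?lee_fin// ltW.
  by rewrite -(integral_marg g mq) integral_qform_dev// lee_fin.
have := plan_dual_le mPsi l0 L0 pg hB.
rewrite /dintegral fstE fstE => /le_trans; apply.
rewrite /dual_objective -/(dintegral _ _) addeAC leeD2r// -EFinD lee_fin.
have : lambda * dl <= e by rewrite mulrA ler_pdivrMr//; nra.
lra.
Qed.

End weak_duality.

(** * Multipliers over plans of finite weight *)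

Section slater.
Context (Psi : X -> R) (mPsi : measurable_fun [set: borel X] Psi).

(** A single weight controls cost, second moment and gain, hence up to a constant every Lagrangian
    [lagr]. *)
Definition wt (x z : X) : R := d x z `^ p + qform 1%:M (dev x) + `|Psi x|.

Lemma wt_ge0 x z : 0 <= wt x z.
Proof. by rewrite !addr_ge0 ?powR_ge0 ?qform1_ge0. Qed.

Lemma measurable_on_fst (g : borel X -> R) : measurable_fun setT g ->
  measurable_fun [set: Z] (fun z : Z => g z.1).
Proof. by move=> mg; exact: (measurableT_comp mg (@measurable_fst_borel R X)). Qed.

Lemma measurable_wt : measurable_fun [set: Z] (fun z : Z => wt z.1 z.2).
Proof.
apply: measurable_funD; first apply: measurable_funD.
- exact: measurable_cost.
- exact: (measurable_on_fst (measurable_qform_dev 1%:M)).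
- apply: (measurable_on_fst (g := fun x => `|Psi x|)).
  exact: measurableT_comp.
Qed.

Definition good (m : {measure set Z -> \bar R}) :=
  plan nu m /\ (\int[m]_z (wt z.1 z.2)%:E < +oo)%E.

Lemma good_integrable m (F : Z -> R) : good m -> measurable_fun setT F ->
  (forall z, `|F z| <= wt z.1 z.2) -> m.-integrable setT (EFin \o F).
Proof.
move=> [_ gm] mF Fw; apply/integrableP; split; first exact/measurable_EFinP.
apply: le_lt_trans gm; apply: ge0_le_integral => //.
- by apply: measurableT_comp => //; exact/measurable_EFinP.
- by apply/measurable_EFinP; exact: measurable_wt.
- by move=> z _; rewrite /= lee_fin.
Qed.

Lemma good_cost m : good m ->
  m.-integrable setT (EFin \o (fun z : Z => d z.1 z.2 `^ p)).
Proof.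
move=> gm; apply: good_integrable => //; first exact: measurable_cost.
by move=> z; rewrite ger0_norm ?powR_ge0// /wt -addrA lerDl addr_ge0 ?qform1_ge0.
Qed.

Lemma good_Psi m : good m -> m.-integrable setT (EFin \o (fun z : Z => Psi z.1)).
Proof.
move=> gm; apply: good_integrable => //; first exact: measurable_on_fst.
by move=> z; rewrite /wt lerDr addr_ge0 ?qform1_ge0 ?powR_ge0.
Qed.

Lemma good_second_moment m : good m ->
  (\int[marg m]_x (qform 1%:M (dev x))%:E < +oo)%E.
Proof.
move=> gm.
have mq : measurable_fun [set: borel X] (fun x : borel X => (qform 1%:M (dev x))%:E).
  by apply/measurable_EFinP; exact: measurable_qform_dev.
rewrite (integral_marg m mq).
have /integrableP[_] : m.-integrable setT (EFin \o (fun z : Z => qform 1%:M (dev z.1))).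
  apply: good_integrable => //; first exact: (measurable_on_fst (measurable_qform_dev 1%:M)).
  move=> z; rewrite ger0_norm ?qform1_ge0// /wt addrAC lerDr.
  by rewrite addr_ge0 ?powR_ge0.
by under eq_integral do rewrite /= ger0_norm ?qform1_ge0//.
Qed.

Definition gain (m : {measure set Z -> \bar R}) := fine (\int[m]_z (Psi z.1)%:E).
Definition cost (m : {measure set Z -> \bar R}) := fine (\int[m]_z (d z.1 z.2 `^ p)%:E).

Lemma good_mix m1 m2 (t : R) : 0 < t < 1 -> good m1 -> good m2 -> exists m,
  [/\ good m, gain m = t * gain m1 + (1 - t) * gain m2,
      cost m = t * cost m1 + (1 - t) * cost m2 &
      moment (marg m) = t *: moment (marg m1) + (1 - t) *: moment (marg m2)].
Proof.
move=> /andP[t0 t1] g1 g2.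
have s0 : 0 <= 1 - t by rewrite subr_ge0 ltW.
pose a := NngNum (ltW t0); pose b := NngNum s0.
pose m := comb a b m1 m2 measurableT measurableT.
have gm : good m.
  split; first by apply: mix_plan; [rewrite /=; lra|exact: g1.1|exact: g2.1].
  rewrite ge0_integral_comb//.
  - by apply: lte_add_pinfty; apply: lte_mul_pinfty => //; [exact: g1.2|exact: g2.2].
  - by apply/measurable_EFinP; exact: measurable_wt.
  - by move=> z; rewrite lee_fin wt_ge0.
have mixE (F : Z -> R) : measurable_fun setT F ->
    m1.-integrable setT (EFin \o F) -> m2.-integrable setT (EFin \o F) ->
    fine (\int[m]_z (F z)%:E) = t * fine (\int[m1]_z (F z)%:E) +
                                (1 - t) * fine (\int[m2]_z (F z)%:E).
  move=> mF i1 i2; rewrite (integral_comb a b measurableT measurableT mF i1 i2).2.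
  have f1 := integrable_fin_num measurableT i1.
  have f2 := integrable_fin_num measurableT i2.
  by rewrite -(fineK f1) -(fineK f2).
exists m; split => //.
- by apply: mixE; [exact: measurable_on_fst|exact: good_Psi|exact: good_Psi].
- by apply: mixE; [exact: measurable_cost|exact: good_cost|exact: good_cost].
- apply/matrixP => i j; rewrite !mxE.
  have mo : measurable_fun [set: borel X] (fun x : borel X => (out x i j)%:E).
    by apply/measurable_EFinP; exact: measurable_outer.
  rewrite !(integral_marg _ mo); apply: mixE.
  + exact: (measurable_on_fst (measurable_outer i j)).
  + apply: (good_integrable g1); first exact: (measurable_on_fst (measurable_outer i j)).
    move=> z; apply: le_trans (outer_le _ _ _) _.
    by rewrite /wt addrAC lerDr addr_ge0 ?powR_ge0.
  + apply: (good_integrable g2); first exact: (measurable_on_fst (measurable_outer i j)).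
    move=> z; apply: le_trans (outer_le _ _ _) _.
    by rewrite /wt addrAC lerDr addr_ge0 ?powR_ge0.
Qed.

Lemma good_integral_lagr m lambda Lambda : good m ->
  (\int[m]_z (lagr Psi lambda Lambda z.1 z.2)%:E =
   (gain m - lambda * cost m - \tr (Lambda^T *m moment (marg m)))%:E)%E.
Proof.
move=> gm; have iP := good_Psi gm; have ic := good_cost gm.
have mq : measurable_fun [set: borel X] (fun x : borel X => (qform Lambda (dev x))%:E).
  by apply/measurable_EFinP; exact: measurable_qform_dev.
have [C C0 hC] := qform_bound Lambda.
have iq : m.-integrable setT (EFin \o (fun z : Z => qform Lambda (dev z.1))).
  apply/integrableP; split.
    by apply/measurable_EFinP; exact: (measurable_on_fst (measurable_qform_dev Lambda)).
  apply: (@le_lt_trans _ _ (C%:E * \int[marg m]_x (qform 1%:M (dev x))%:E)%E); last first.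
    by apply: lte_mul_pinfty => //; exact: good_second_moment.
  have mq1 : measurable_fun [set: borel X] (fun x : borel X => (qform 1%:M (dev x))%:E).
    by apply/measurable_EFinP; exact: measurable_qform_dev.
  rewrite (integral_marg m mq1) -ge0_integralZl_EFin//; last first.
  - exact: (measurableT_comp mq1 (@measurable_fst_borel R X)).
  - by move=> z _; rewrite lee_fin qform1_ge0.
  apply: ge0_le_integral => //.
  - apply: measurableT_comp => //; apply/measurable_EFinP.
    exact: (measurable_on_fst (measurable_qform_dev Lambda)).
  - by apply: measurable_funeM; exact: (measurableT_comp mq1 (@measurable_fst_borel R X)).
  - by move=> z _; rewrite /= -EFinM lee_fin.
rewrite /lagr; under eq_integral do rewrite !EFinB EFinM.
rewrite integralB//; last by apply: integrableB => //; exact: integrableZl.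
rewrite integralB//; last exact: integrableZl.
rewrite integralZl// -(integral_marg m mq) integral_qform_dev; last first.
  exact: good_second_moment.
have f1 := integrable_fin_num measurableT iP.
have f2 := integrable_fin_num measurableT ic.
by rewrite -(fineK f1) -(fineK f2).
Qed.

(** The multipliers bound the integral of the Lagrangian over all good plans by [b]; exchanging
    supremum and integral transfers the bound to phi. The lemma will also be applied to the positive
    part of the original gain function. *)
Lemma slater_strong_duality g0 (v e0 : R) : good g0 -> cost g0 < R0 `^ p ->
  0 < e0 ->
  (forall u, qform (moment (marg g0)) u + e0 * qform 1%:M u <= qform Sigma0 u) ->
  (forall m, feasible m -> good m -> gain m <= v) ->
  exists (lambda : R) (Lambda : 'M[R]_K), [/\ 0 <= lambda, psdmx Lambda &
    (dual_objective p R0 m0 Sigma0 nu Psi lambda Lambda <= v%:E)%E].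
Proof.
move=> gg0 c0 e00 M0 bd.
pose P := {m : {measure set Z -> \bar R} | good m}.
have [lambda [Lambda [l0 L0 hL]]] : exists (lambda : R) (Lambda : 'M[R]_K),
  [/\ 0 <= lambda, psdmx Lambda & forall g : P,
    gain (sval g) <= v + lambda * (cost (sval g) - R0 `^ p) +
      \tr (Lambda^T *m (moment (marg (sval g)) - Sigma0))].
  apply: (@lagrange_multipliers R K P (gain \o sval) (cost \o sval)
    (fun g => moment (marg (sval g))) (R0 `^ p) v Sigma0
    (exist _ g0 gg0) e0) => //=.
  - move=> [m1 g1] [m2 g2] t t01; have [m [gm h1 h2 h3]] := good_mix t01 g1 g2.
    by exists (exist _ m gm).
  - move=> [m gm] /= cm Mm; apply: bd => //; split; first exact: gm.1.
      have f := integrable_fin_num measurableT (good_cost gm).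
      by rewrite -(fineK f) lee_fin.
    by move=> u; rewrite qform_moment ?lee_fin//; exact: good_second_moment.
  - by move=> g; exact: moment_sym.
exists lambda, Lambda; split => //.
have [C C0 hC] := qform_bound Lambda.
pose b := v - lambda * R0 `^ p - \tr (Lambda^T *m Sigma0).
suff : (dintegral nu (dual_integrand p m0 Psi lambda Lambda) <= b%:E)%E.
  rewrite /dual_objective => /(leeD2l (lambda * R0 `^ p + \tr (Lambda^T *m Sigma0))%:E).
  by move=> /le_trans; apply; rewrite -EFinD lee_fin /b; lra.
rewrite dual_integrandE.
(* The summands of the constant bound the terms Psi, lambda d^p and the quadratic form, in this
   order. *)
apply: (@dintegral_sup_le R X nu (lagr Psi lambda Lambda) wt (1 + lambda + C)
  _ _ _ _ _ _ g0 b) => //.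
- apply: measurable_funB; last exact: (measurable_on_fst (measurable_qform_dev Lambda)).
  apply: measurable_funB; first exact: measurable_on_fst.
  by apply: measurable_funM => //; exact: measurable_cost.
- exact: measurable_wt.
- by rewrite !addr_ge0.
- exact: wt_ge0.
- move=> x z; rewrite /lagr /wt.
  have h1 := hC (dev x); have h2 := qform1_ge0 (dev x).
  have h3 := powR_ge0 (d x z) p; have h4 := normr_ge0 (Psi x).
  apply: le_trans (ler_normB _ _) _.
  apply: le_trans (lerD (ler_normB _ _) (lexx _)) _.
  rewrite normrM (ger0_norm l0) (ger0_norm h3).
  by nra.
- by move=> xi a; exact: lagr_open.
- exact: gg0.1.
- exact: gg0.2.
- move=> m pm im; have gm : good m by split.
  rewrite good_integral_lagr// lee_fin.
  have := hL (exist _ m gm); rewrite /= mulmxBr linearB /= /b; lra.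
Qed.

End slater.


(** * Strong duality *)

(** A crude Cauchy-Schwarz inequality; its factor only affects how small the rerouted piece has to
    be. *)
Lemma qform_outer_le (u v : 'cV[R]_K) :
  qform (u *m u^T) v <= (K * K)%:R * (qform 1%:M u * qform 1%:M v).
Proof.
have hi (w : 'cV[R]_K) k : w k 0 ^+ 2 <= qform 1%:M w.
  by rewrite qform1 (bigD1 k)//= lerDl; apply: sumr_ge0 => l _; exact: sqr_ge0.
have hij (w : 'cV[R]_K) i j : `|w i 0 * w j 0| <= qform 1%:M w.
  by rewrite ler_norml; apply/andP; split; have := hi w i; have := hi w j; nra.
rewrite qformE.
apply: (@le_trans _ _ (\sum_(i < K) \sum_(j < K) qform 1%:M u * qform 1%:M v)).
  apply: ler_sum => i _; apply: ler_sum => j _.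
  have -> : (u *m u^T) i j = u i 0 * u j 0 by rewrite mxE big_ord1 [X in _ * X]mxE.
  apply: le_trans (ler_norm _) _; rewrite normrM.
  by apply: ler_pM.
rewrite !sumr_const !card_ord -mulrnA mulr_natl lexx//.
Qed.

Definition diag : {measure set Z -> \bar R} := graph_plan nu (T := id) (@measurable_diag_borel R X).

Lemma diag_plan : plan nu diag.
Proof. exact: graph_plan_plan. Qed.

Lemma diag_cost : (\int[diag]_z (d z.1 z.2 `^ p)%:E = 0)%E.
Proof.
rewrite ge0_integral_graph_plan//=.
- rewrite integral0_eq// => x _.
  by rewrite (dist_xx hd) powR0// gt_eqF// (lt_le_trans _ p1).
- by apply/measurable_EFinP; exact: measurable_cost.
- by move=> z; rewrite lee_fin powR_ge0.
Qed.

Lemma integral_marg_diag (g : borel X -> \bar R) : measurable_fun setT g ->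
  (\int[marg diag]_x g x = \int[nu]_x g x)%E.
Proof.
by move=> mg; apply: eq_measure_integral => A mA _.
Qed.

Lemma nneseries_half_le (x : nat -> \bar R) (r : R) : 0 <= r ->
  (forall n, (0 <= x n)%E) -> (forall n, (x n <= r%:E)%E) ->
  (\sum_(0 <= n <oo) ((1 / (2 ^ (n + 1))%:R : R)%:E * x n) <= r%:E)%E.
Proof.
move=> r0 xge0 xr.
apply: (@le_trans _ _ (\sum_(0 <= n <oo) (r%:E * (1 / (2 ^ (n + 1))%:R)%:E))%E).
  apply: lee_nneseries => n _; first by rewrite mule_ge0.
  by rewrite muleC; apply: lee_wpmul2r.
rewrite nneseriesZl => [|n _]; last by rewrite lee_fin.
by rewrite (cvg_lim _ (@cvg_geometric_eseries_half R 1 0))// expr0 divr1 mule1.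
Qed.

Section strong_duality.
Context (Psi : X -> R) (mPsi : measurable_fun [set: borel X] Psi).
Hypothesis pd : loewner_lt (second_moment m0 nu) Sigma0.
Local Notation psi := (EFin \o Psi).
Local Notation primal := (primal_value p R0 m0 Sigma0 nu Psi).

Let mpos : measurable_fun [set: borel X] psi^\+%E.
Proof. by apply: measurable_funepos; exact/measurable_EFinP. Qed.

Let mneg : measurable_fun [set: borel X] psi^\-%E.
Proof. by apply: measurable_funeneg; exact/measurable_EFinP. Qed.

Lemma nu_slater : exists2 e0 : R, 0 < e0 &
  forall u, qform (moment nu) u + e0 * qform 1%:M u <= qform Sigma0 u.
Proof.
have [e0 e00 he] := pdmx_coercive pd; exists e0 => // u.
have := he u; rewrite qformD qformN.
have -> : second_moment m0 nu = moment nu by apply/matrixP => i j; rewrite !mxE.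
by lra.
Qed.

Lemma moment_diag : moment (marg diag) = moment nu.
Proof.
by apply/matrixP => i j; rewrite !mxE.
Qed.

Lemma diag_feasible : feasible diag.
Proof.
split; first exact: diag_plan.
  by rewrite diag_cost lee_fin powR_ge0.
move=> u; have [e0 e00 he] := nu_slater.
have -> : (\int[marg diag]_x (qform (u *m u^T) (dev x))%:E =
    (qform (moment (marg diag)) u)%:E)%E.
  by apply: qform_moment; exact: probability_second_moment.
rewrite lee_fin moment_diag; apply: le_trans (he u).
by rewrite lerDl mulr_ge0 ?qform1_ge0// ltW.
Qed.

Hypothesis primal_fin : (primal < +oo)%E.

(** Under the dual addition an infinite positive part makes the gain +oo whatever the negative part
    is. *)
Lemma feasible_pos_fin m : feasible m -> (\int[marg m]_x psi^\+ x < +oo)%E.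
Proof.
move=> fm; rewrite ltey; apply/eqP => h.
by move: (primal_ge Psi fm) primal_fin; rewrite h /= leye_eq => /eqP->.
Qed.

(* A mixture of feasible plans whose gains grow like 2^n would be feasible with
   an infinite gain. *)
Lemma feasible_pos_bounded :
  exists B : R, forall m, feasible m -> (\int[marg m]_x psi^\+ x <= B%:E)%E.
Proof.
apply: contrapT => nB.
have /choice[m hm] : forall n : nat, exists m, feasible m /\
    (((2 ^ (n + 1))%:R : R)%:E <= \int[marg m]_x psi^\+ x)%E.
  move=> n; apply: contrapT => nm; apply: nB; exists (2 ^ (n + 1))%:R => m fm.
  by rewrite leNgt; apply/negP => h; apply: nm; exists m; split => //; exact: ltW.
have [m' [pm' m'E]] := series_plan (fun n => let: And3 h _ _ := (hm n).1 in h).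
have fstm (g : borel X -> \bar R) : measurable_fun setT g ->
    measurable_fun [set: Z] (fun z : Z => g z.1).
  by move=> mg; exact: (measurableT_comp mg (@measurable_fst_borel R X)).
have margE (g : borel X -> \bar R) : measurable_fun setT g ->
    (forall x, 0 <= g x)%E -> (\int[marg m']_x g x =
     \sum_(0 <= n <oo) ((1 / (2 ^ (n + 1))%:R : R)%:E * \int[marg (m n)]_x g x))%E.
  move=> mg g0; rewrite ge0_integral_marg// m'E//; last exact: fstm.
  by apply: eq_eseriesr => n _; rewrite ge0_integral_marg.
have fm' : feasible m'.
  split => //.
    rewrite m'E.
    - apply: nneseries_half_le; first exact: powR_ge0.
        by move=> n; apply: integral_ge0 => z _; rewrite lee_fin powR_ge0.
      by move=> n; have [[_ + _] _] := hm n.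
    - by apply/measurable_EFinP; exact: measurable_cost.
    - by move=> z; rewrite lee_fin powR_ge0.
  move=> u; rewrite margE.
  - apply: nneseries_half_le.
    + have [e0 e00 he] := nu_slater; have := (he u).
      apply: le_trans; rewrite addr_ge0 ?mulr_ge0 ?qform1_ge0 ?(ltW e00)//.
      rewrite -lee_fin -qform_moment; last exact: probability_second_moment.
      by apply: integral_ge0 => x _; rewrite lee_fin qform_outer_ge0.
    + by move=> n; apply: integral_ge0 => z _; rewrite lee_fin qform_outer_ge0.
    + by move=> n; have [[_ _ +] _] := hm n; apply.
  - by apply/measurable_EFinP; exact: measurable_qform_dev.
  - by move=> x; rewrite lee_fin qform_outer_ge0.
have := feasible_pos_fin fm'; rewrite margE// ltNge => /negP; apply.
rewrite leye_eq; apply/eqP/eqyP => A A0.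
have t0 n : (0 <= (1 / (2 ^ (n + 1))%:R : R)%:E * \int[marg (m n)]_x psi^\+ x)%E.
  by rewrite mule_ge0 ?lee_fin//; apply: integral_ge0.
(* The first N terms exceed [A], each weighted term being at least 1 by the choice of [m n]. *)
pose N := (Num.truncn A).+1.
apply: (@le_trans _ _ (\sum_(0 <= n < N) 1)%E); last first.
  apply: le_trans _ (nneseries_lim_ge N (fun n _ _ => t0 n)).
  apply: lee_sum => n _; have [_ hn] := hm n.
  apply: (@le_trans _ _ ((1 / (2 ^ (n + 1))%:R : R)%:E * ((2 ^ (n + 1))%:R)%:E)%E).
    by rewrite -EFinM divfK// pnatr_eq0 expn_eq0.
  by apply: lee_wpmul2l => //; rewrite lee_fin.
rewrite sumEFin lee_fin sumr_const_nat subn0; exact/ltW/truncnS_gt.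
Qed.

Let wt0 (x z : X) : R := d x z `^ p + qform 1%:M (dev x).

Let wt0_ge0 x z : 0 <= wt0 x z.
Proof. by rewrite addr_ge0 ?powR_ge0 ?qform1_ge0. Qed.

Let mwt0 : measurable_fun [set: Z] (fun z : Z => (wt0 z.1 z.2)%:E).
Proof.
apply/measurable_EFinP; apply: measurable_funD; first exact: measurable_cost.
exact: (measurable_on_fst (measurable_qform_dev 1%:M)).
Qed.

(** Finite cost and second moment stand in for the constraints, as only a piece of [g] of small
    weight will be used. *)
Let reachable := exists g, [/\ plan nu g, (\int[g]_z (wt0 z.1 z.2)%:E < +oo)%E &
  (\int[marg g]_x psi^\- x < +oo)%E].

Lemma good_of_feasible m : feasible m -> (\int[marg m]_x psi^\- x < +oo)%E ->
  good Psi m.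
Proof.
move=> fm nm; have [pm cm _] := fm; split => //.
have m2 := feasible_second_moment fm; have ppm := feasible_pos_fin fm.
have mq : measurable_fun [set: borel X] (fun x : borel X => (qform 1%:M (dev x))%:E).
  by apply/measurable_EFinP; exact: measurable_qform_dev.
have mc : measurable_fun [set: Z] (fun z : Z => (d z.1 z.2 `^ p)%:E).
  by apply/measurable_EFinP; exact: measurable_cost.
have ma : measurable_fun [set: borel X] (fun x : borel X => `|Psi x|%:E).
  by apply/measurable_EFinP; exact: measurableT_comp.
have fstm (g : borel X -> \bar R) : measurable_fun setT g ->
    measurable_fun [set: Z] (fun z : Z => g z.1).
  by move=> mg; exact: (measurableT_comp mg (@measurable_fst_borel R X)).
have c0 (z : Z) : (0 <= (d z.1 z.2 `^ p)%:E)%E by rewrite lee_fin powR_ge0.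
have q0 (z : Z) : (0 <= (qform 1%:M (dev z.1))%:E)%E by rewrite lee_fin qform1_ge0.
rewrite /wt; under eq_integral do rewrite !EFinD.
have mcq : measurable_fun [set: Z]
    (fun z : Z => (d z.1 z.2 `^ p)%:E + (qform 1%:M (dev z.1))%:E)%E.
  exact: (emeasurable_funD mc (fstm _ mq)).
rewrite ge0_integralD; do ?[exact: measurableT|exact: mcq|exact: (fstm _ ma)|
  by move=> z _; rewrite lee_fin|by move=> z _; rewrite adde_ge0].
rewrite ge0_integralD; do ?[exact: measurableT|exact: mc|exact: (fstm _ mq)|
  by move=> z _].
rewrite -(integral_marg m mq) -(integral_marg m ma).
apply: lte_add_pinfty; first by apply: lte_add_pinfty => //; apply: le_lt_trans cm (ltry _).
have -> : (\int[marg m]_x `|Psi x|%:E = \int[marg m]_x (psi^\+ x + psi^\- x))%E.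
  by apply: eq_integral => x _; rewrite -[RHS]/((psi^\+ \+ psi^\-)%E x) -fune_abse.
by rewrite ge0_integralD//; exact: lte_add_pinfty.
Qed.

Lemma strong_duality_reachable : reachable ->
  exists (lambda : R) (Lambda : 'M[R]_K), [/\ 0 <= lambda, psdmx Lambda &
    (dual_objective p R0 m0 Sigma0 nu Psi lambda Lambda <= primal)%E].
Proof.
move=> [g1 [pg1 ig1 ng1]]; have [e0 e00 he] := nu_slater.
pose A (n : nat) : set (borel X) := [set x | - n%:R <= Psi x].
have mA n : measurable (A n).
  rewrite -[X in measurable X]setTI (_ : A n = Psi @^-1` `[(- n%:R), +oo[%classic).
    exact: mPsi.
  by apply/seteqP; split => z /=; rewrite in_itv /= andbT.
have RP0 : 0 < R0 `^ p by rewrite powR_gt0.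
pose KK : R := (K * K)%:R + 1.
have KK0 : 0 < KK by rewrite ltr_wpDl.
(* The first bound keeps the cost below R0^p, the diagonal costing nothing; the second spends at
   most half of the Slater slack [e0]. The 1 in [KK] keeps it positive for K = 0. *)
pose dl := Num.min (R0 `^ p) (e0 / 2 / KK).
have dl0 : 0 < dl by rewrite lt_min RP0 !divr_gt0.
have [n tn] : exists n, (\int[g1]_(z in snd @^-1` (~` A n)) (wt0 z.1 z.2)%:E < dl%:E)%E.
  have := @ge0_integral_tail _ Z R g1 (fun z : Z => (wt0 z.1 z.2)%:E)
    (fun n => snd @^-1` A n) dl mwt0.
  move=> /(_ _ ig1 (fun n => measurable_snd_preimage (mA n)) _ _ dl0)/wrap[].
  - by move=> z; rewrite lee_fin.
  - move=> i j ij z /=; apply: le_trans; by rewrite lerN2 ler_nat.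
  - rewrite -preimage_bigcup; apply/seteqP; split => // z _.
    exists (Num.truncn (- Psi z.2)).+1 => //=; rewrite /A/= lerNl.
    exact/ltW/truncnS_gt.
  - by move=> [n _ /(_ n (leqnn _)) h]; exists n.
pose g := glued diag g1 (mA n).
have pg : plan nu g by apply: glued_plan => //; exact: diag_plan.
have mD := measurable_snd_preimage (mA n).
have mD' := measurable_snd_preimage (measurableC (mA n)).
have fstm (h : borel X -> \bar R) : measurable_fun setT h ->
    measurable_fun [set: Z] (fun z : Z => h z.1).
  by move=> mh; exact: (measurableT_comp mh (@measurable_fst_borel R X)).
have mq B : measurable_fun [set: borel X] (fun x : borel X => (qform B (dev x))%:E).
  by apply/measurable_EFinP; exact: measurable_qform_dev.
have mc : measurable_fun [set: Z] (fun z : Z => (d z.1 z.2 `^ p)%:E).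
  by apply/measurable_EFinP; exact: measurable_cost.
have c0 (z : Z) : (0 <= (d z.1 z.2 `^ p)%:E)%E by rewrite lee_fin powR_ge0.
have cg : (\int[g]_z (d z.1 z.2 `^ p)%:E < (R0 `^ p)%:E)%E.
  rewrite ge0_integral_glued//.
  have -> : (\int[diag]_(z in snd @^-1` A n) (d z.1 z.2 `^ p)%:E = 0)%E.
    apply/eqP; rewrite eq_le integral_ge0// andbT -diag_cost.
    exact: ge0_subset_integral.
  rewrite add0e; apply: (@lt_le_trans _ _ dl%:E); last by rewrite lee_fin ge_min lexx.
  apply: le_lt_trans tn; apply: ge0_le_integral => //.
  - exact: measurable_funTS.
  - exact: measurable_funTS.
  - by move=> z _; rewrite lee_fin lerDl qform1_ge0.
have Mg u : (\int[marg g]_x (qform (u *m u^T) (dev x))%:E <=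
    (qform Sigma0 u - (e0 / 2) * qform 1%:M u)%:E)%E.
  rewrite (integral_marg g (mq (u *m u^T))) ge0_integral_glued; do ?[exact: (fstm _ (mq (u *m u^T)))|
    by move=> x; rewrite lee_fin qform_outer_ge0].
  have h1 : (\int[diag]_(z in snd @^-1` A n) (qform (u *m u^T) (dev z.1))%:E <=
      (qform (moment nu) u)%:E)%E.
    rewrite -qform_moment; last exact: probability_second_moment.
    rewrite -(integral_marg_diag (mq (u *m u^T))) (integral_marg diag (mq (u *m u^T))).
    apply: ge0_subset_integral => //; first exact: (fstm _ (mq (u *m u^T))).
    by move=> x _; rewrite lee_fin qform_outer_ge0.
  have h2 : (\int[g1]_(z in snd @^-1` (~` A n)) (qform (u *m u^T) (dev z.1))%:E <=
      ((K * K)%:R * qform 1%:M u * dl)%:E)%E.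
    apply: (@le_trans _ _ (((K * K)%:R * qform 1%:M u)%:E *
        \int[g1]_(z in snd @^-1` (~` A n)) (wt0 z.1 z.2)%:E)%E).
      rewrite -ge0_integralZl_EFin; do ?[by []|exact: measurable_funTS|
        by move=> z _; rewrite lee_fin|by rewrite mulr_ge0 ?qform1_ge0].
      apply: ge0_le_integral => //.
      - by move=> x _; rewrite lee_fin qform_outer_ge0.
      - by apply: measurable_funTS; exact: (fstm _ (mq (u *m u^T))).
      - by apply: measurable_funeM; exact: measurable_funTS.
      - move=> z _; rewrite -EFinM lee_fin; apply: le_trans (qform_outer_le _ _) _.
        rewrite mulrA; apply: ler_wpM2l; first by rewrite mulr_ge0 ?qform1_ge0.
        by rewrite lerDr powR_ge0.
    rewrite [leRHS]EFinM; apply: lee_wpmul2l; last exact: ltW.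
    by rewrite lee_fin mulr_ge0 ?qform1_ge0.
  apply: le_trans (leeD h1 h2) _; rewrite -EFinD lee_fin.
  have h3 : dl * KK <= e0 / 2 by rewrite -ler_pdivlMr// ge_min lexx orbT.
  have := he u; have := qform1_ge0 u; have : 0 <= dl by exact: ltW.
  rewrite /KK in h3; nra.
have fg : feasible g.
  split => //; first exact: ltW.
  move=> u; apply: le_trans (Mg u) _; rewrite lee_fin gerBl mulr_ge0 ?qform1_ge0//.
  by rewrite divr_ge0// ltW.
have ng : (\int[marg g]_x psi^\- x < +oo)%E.
  rewrite ge0_integral_marg// ge0_integral_glued//; last exact: fstm.
  (* Over [A n] the plan is diagonal and the negative part of Psi is at most n; elsewhere it is that
     of [g1], which is integrable. *)
  apply: lte_add_pinfty.
    rewrite ge0_integral_graph_plan//=; last exact: fstm.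
    apply: (@le_lt_trans _ _ (\int[nu]_(x in A n) (cst n%:R%:E) x)%E).
      apply: (ge0_le_integral nu (mA n)) => //; first exact: measurable_funTS.
      move=> x /= Ax; rewrite funenegE ge_max; apply/andP; split.
        by rewrite /= lee_fin lerNl.
      by rewrite lee_fin ler0n.
    rewrite integral_cst//; apply: lte_mul_pinfty => //.
    by rewrite -ge0_fin_numE// fin_num_measure.
  apply: le_lt_trans ng1; rewrite (ge0_integral_marg g1)//.
  by apply: ge0_subset_integral => //; exact: fstm.
have gg := good_of_feasible fg ng.
have dE m : good Psi m -> ((\int[marg m]_x psi^\+ x)%E - (\int[marg m]_x psi^\- x)%E)%dE =
    (gain Psi m)%:E.
  move=> gm; have mE : (\int[m]_z psi z.1 = \int[marg m]_x psi x)%E.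
    by rewrite integral_marg//; exact/measurable_EFinP.
  have fP : (\int[marg m]_x psi x)%E \is a fin_num.
    by rewrite -mE; exact: (integrable_fin_num measurableT (good_Psi mPsi gm)).
  have -> : (gain Psi m)%:E = (\int[marg m]_x psi x)%E by rewrite -mE fineK// mE.
  have P0 : (0 <= \int[marg m]_x psi^\+ x)%E by exact: integral_ge0.
  have N0 : (0 <= \int[marg m]_x psi^\- x)%E by exact: integral_ge0.
  have E := integralE (marg m) setT psi; rewrite E in fP; rewrite E.
  move: fP P0 N0; move: (\int[marg m]_x psi^\+ x)%E (\int[marg m]_x psi^\- x)%E.
  by move=> [a| |] [b| |].
have primal_num : primal \is a fin_num.
  rewrite fin_numE; apply/andP; split; last by rewrite -ltey.
  by have := primal_ge Psi fg; rewrite dE// -ltNye; apply: lt_le_trans; rewrite ltNyr.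
rewrite -(fineK primal_num).
apply: (@slater_strong_duality Psi mPsi g _ (e0 / 2)) => //.
- have f := integrable_fin_num measurableT (good_cost mPsi gg).
  by rewrite -lte_fin /cost fineK.
- exact: divr_gt0.
- move=> u; have := Mg u; rewrite qform_moment ?lee_fin; first lra.
  exact: (feasible_second_moment fg).
- by move=> m fm gm; rewrite -lee_fin -dE// (fineK primal_num); exact: primal_ge.
Qed.



(* Without a reachable plan the gain is -oo throughout; the multipliers for the
   positive part of Psi, increased by one unit, then make the dual -oo too. *)
Lemma strong_duality_unreachable : ~ reachable ->
  exists (lambda : R) (Lambda : 'M[R]_K), [/\ 0 <= lambda, psdmx Lambda &
    (dual_objective p R0 m0 Sigma0 nu Psi lambda Lambda <= primal)%E].
Proof.
move=> nreach; have [e0 e00 he] := nu_slater; have [B hB] := feasible_pos_bounded.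
have p0 : 0 < p by exact: lt_le_trans p1.
(* For the positive part the diagonal plan is good, and its strict feasibility yields multipliers
   with a finite dual bound [B]. *)
pose Psip (x : X) := Num.max (Psi x) 0.
have PsipE x : (Psip x)%:E = psi^\+%E x by rewrite funeposE /= EFin_max.
have mPsip : measurable_fun [set: borel X] Psip.
  by apply/measurable_EFinP; rewrite (_ : EFin \o _ = psi^\+%E)//; apply/funext => x; exact: PsipE.
have gd : good Psip diag.
  split; first exact: diag_plan.
  rewrite ge0_integral_graph_plan; do ?[exact: measurableT|
    by apply/measurable_EFinP; exact: (measurable_wt mPsip)|
    by move=> z; rewrite lee_fin wt_ge0].
  rewrite preimage_setT (eq_integral (fun x : borel X => (qform 1%:M (dev x))%:E + psi^\+ x)%E); last first.
    move=> x _; rewrite /wt /= (dist_xx hd) powR0 ?gt_eqF// add0r EFinD; congr (_ + _)%E.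
    by rewrite ger0_norm ?PsipE// le_max lexx orbT.
  have mq : measurable_fun [set: borel X] (fun x : borel X => (qform 1%:M (dev x))%:E).
    by apply/measurable_EFinP; exact: measurable_qform_dev.
  rewrite ge0_integralD; do ?[exact: measurableT|exact: mq|exact: mpos|
    by move=> x _; rewrite lee_fin qform1_ge0|by move=> x _].
  apply: lte_add_pinfty; first exact: probability_second_moment.
  by rewrite -(integral_marg_diag mpos); exact: (feasible_pos_fin diag_feasible).
have cd : cost diag < R0 `^ p.
  by rewrite /cost diag_cost /= powR_gt0.
have Md u : qform (moment (marg diag)) u + e0 * qform 1%:M u <= qform Sigma0 u.
  by rewrite moment_diag; exact: he.
have bd m : feasible m -> good Psip m -> gain Psip m <= B.
  move=> fm gm; rewrite -lee_fin /gain fineK; last first.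
    exact: (integrable_fin_num measurableT (good_Psi mPsip gm)).
  have mE : measurable_fun [set: borel X] (fun x : borel X => (Psip x)%:E).
    exact/measurable_EFinP.
  rewrite -(integral_marg m mE) (eq_integral (fun x : borel X => psi^\+%E x)) => [|x _]; last exact: PsipE.
  exact: hB.
have [l [L [l0 L0 hl]]] := slater_strong_duality mPsip gd cd e00 Md bd.
pose phip := dual_integrand p m0 Psip l L.
(* Otherwise the dual addition would make the dual objective +oo, against the bound [B]. *)
have Ipp : (\int[nu]_z phip^\+ z < +oo)%E.
  rewrite ltey; apply/eqP => h; move: hl; rewrite /dual_objective /dintegral h.
  by [].
pose f1 := lagr Psi l L; pose phi1 := sup_fst f1.
pose l2 := l + 1; pose L2 := L + 1%:M.
have l20 : 0 <= l2 by rewrite addr_ge0.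
have L20 : psdmx L2.
  split; first by rewrite linearD /= trmx1 L0.1.
  move=> u; rewrite -/(qform _ _) qformD addr_ge0 ?qform1_ge0//; exact: L0.2.
pose f2 := lagr Psi l2 L2; pose phi2 := sup_fst f2.
(* Raising both multipliers by one unit subtracts exactly the weight of a plan. *)
have f12 x z : f1 x z - f2 x z = wt0 x z.
  by rewrite /f1 /f2 /lagr /l2 /L2 qformD /wt0; lra.
have mphi1 : measurable_fun [set: borel X] phi1.
  by apply: sup_fst_measurable => xi a; exact: lagr_open.
have mphi2 : measurable_fun [set: borel X] phi2.
  by apply: sup_fst_measurable => xi a; exact: lagr_open.
have le_sup (f g : X -> X -> R) z : (forall x, f x z <= g x z) ->
    (sup_fst f z <= sup_fst g z)%E.
  move=> fg; apply: ge_ereal_sup => _ [x _ <-].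
  by apply: le_trans (sup_fst_ge g x z); rewrite lee_fin.
have le_pos (f g : X -> \bar R) : measurable_fun [set: borel X] f ->
    measurable_fun [set: borel X] g -> (forall z, (f z <= g z)%E) ->
    (\int[nu]_z f^\+ z <= \int[nu]_z g^\+ z)%E.
  move=> mf mg fg; apply: ge0_le_integral => //; do ?exact: measurable_funepos.
  by move=> z _; rewrite !funeposE ge_max !le_max fg lexx orbT.
have I1 : (\int[nu]_z phi1^\+ z < +oo)%E.
  have mphip : measurable_fun [set: borel X] phip.
    by apply: sup_fst_measurable => xi a; exact: lagr_open.
  apply: le_lt_trans Ipp; apply: le_pos => // z; apply: (@le_sup f1 (lagr Psip l L)) => x.
  by rewrite /f1 /lagr !lerD2r le_max lexx.
have I2 : (\int[nu]_z phi2^\+ z < +oo)%E.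
  apply: le_lt_trans I1; apply: le_pos => // z; apply: (@le_sup f2 f1) => x.
  by rewrite -subr_ge0 f12.
(* If this were finite, a near-maximiser T of [f2] would give a reachable plan: along its graph
   [wt0] = [f1] - [f2] <= phi1^+ + phi2^- + 1, and the negative part of Psi is at most phi2^- + 1
   because the penalties are nonnegative. *)
have N2 : (\int[nu]_z phi2^\- z)%E = +oo%E.
  apply: contrapT => /eqP; rewrite -ltey => N2; apply: nreach.
  pose hm (z : X) := fine (phi2^\-%E z); pose h z := - hm z - 1.
  have hmE z : (hm z)%:E = phi2^\-%E z by rewrite fineK// sup_fst_neg_fin.
  have mneg2 : measurable_fun [set: borel X] phi2^\-%E by exact: measurable_funeneg.
  have mhm : measurable_fun [set: borel X] hm by exact: measurableT_comp.
  have mh : measurable_fun [set: borel X] h.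
    by apply: measurable_funB => //; exact: measurableT_comp.
  have fo xi a : open [set z | a < f2 xi z] by exact: lagr_open.
  have hphi z : exists xi, h z < f2 xi z.
    apply: lt_sup_fst; apply: (@lt_le_trans _ _ (- phi2^\- z)%E).
      by rewrite -hmE -EFinN lte_fin /h; lra.
    by rewrite funenegE leeNl le_max lexx.
  have [T [mT hT]] := measurable_selection fo mh hphi.
  exists (graph_plan nu mT); split; first exact: graph_plan_plan.
    rewrite ge0_integral_graph_plan//; last by move=> z; rewrite lee_fin.
    rewrite preimage_setT.
    apply: (@le_lt_trans _ _ (\int[nu]_z (phi1^\+ z + (phi2^\- z + 1)))%E).
      apply: ge0_le_integral => //.
      - by move=> z _; rewrite lee_fin.
      - exact: (measurableT_comp mwt0 mT).
      - apply: emeasurable_funD; first exact: measurable_funepos.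
        by apply: emeasurable_funD.
      - move=> z _; rewrite -f12 EFinB; apply: leeD.
          by rewrite funeposE le_max sup_fst_ge.
        rewrite -hmE -EFinN -EFinD lee_fin; have := hT z; rewrite /h; lra.
    rewrite ge0_integralD//; last 3 first.
    - exact: measurable_funepos.
    - by move=> z _; rewrite adde_ge0.
    - exact: emeasurable_funD.
    apply: lte_add_pinfty => //; rewrite ge0_integralD//.
    apply: lte_add_pinfty => //; rewrite integral_cst//.
    by rewrite mul1e -ge0_fin_numE// fin_num_measure.
  rewrite ge0_integral_marg// ge0_integral_graph_plan//; last first.
    exact: (measurableT_comp mneg (@measurable_fst_borel R X)).
  rewrite preimage_setT.
  apply: (@le_lt_trans _ _ (\int[nu]_z (phi2^\- z + 1))%E).
    apply: ge0_le_integral => //.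
    - exact: (measurableT_comp mneg (measurableT_comp (@measurable_fst_borel R X) mT)).
    - exact: emeasurable_funD.
    - move=> z _; rewrite funenegE ge_max adde_ge0// andbT /= -hmE -EFinD lee_fin.
      have := hT z; rewrite /h /f2 /lagr.
      have := mulr_ge0 l20 (powR_ge0 (d (T z) z) p); have := L20.2 (dev (T z)).
      by rewrite -/(qform _ _); lra.
  rewrite ge0_integralD//; apply: lte_add_pinfty => //; rewrite integral_cst//.
  by rewrite mul1e -ge0_fin_numE// fin_num_measure.
exists l2, L2; split => //.
(* A finite positive part against an infinite negative part gives -oo. *)
rewrite /dual_objective dual_integrandE -/f2 -/phi2 /dintegral N2.
have : (0 <= \int[nu]_z phi2^\+ z)%E by exact: integral_ge0.
by move: I2; case: (\int[nu]_z phi2^\+ z)%E => [r| |] //= _ _; rewrite leNye.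
Qed.

Lemma strong_duality :
  exists (lambda : R) (Lambda : 'M[R]_K), [/\ 0 <= lambda, psdmx Lambda &
    (dual_objective p R0 m0 Sigma0 nu Psi lambda Lambda <= primal)%E].
Proof.
have [h|h] := pselect reachable; first exact: strong_duality_reachable.
exact: strong_duality_unreachable.
Qed.

End strong_duality.

End feasible.

Theorem theorem1 (R : realType) (K : nat) (Xi : set 'cV[R]_K)
    (d : Xi -> Xi -> R) (hd : is_metric d) (zeta0 : Xi)
    (p R0 : R) (m0 : 'cV[R]_K) (Sigma0 : 'M[R]_K)
    (nu : probability (borel (metric_sub hd zeta0)) R)
    (Psi : metric_sub hd zeta0 -> R) :
  1 <= p -> 0 < R0 -> psdmx Sigma0 ->
  upper_semicontinuous Psi ->
  (growth_rate p Psi zeta0 < +oo)%E ->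
  has_second_moment m0 nu ->
  loewner_lt (second_moment m0 nu) Sigma0 ->
  exists (lambda : R) (Lambda : 'M[R]_K),
    [/\ 0 <= lambda, psdmx Lambda,
        primal_value p R0 m0 Sigma0 nu Psi
          = dual_objective p R0 m0 Sigma0 nu Psi lambda Lambda &
        forall (lambda' : R) (Lambda' : 'M[R]_K),
          0 <= lambda' -> psdmx Lambda' ->
          (dual_objective p R0 m0 Sigma0 nu Psi lambda Lambda
            <= dual_objective p R0 m0 Sigma0 nu Psi lambda' Lambda')%E].
Proof.
move=> p1 R00 [sym0 _] usc _ nu2 pd; have mPsi := usc_measurable usc.
have weak l L : 0 <= l -> psdmx L -> (primal_value p R0 m0 Sigma0 nu Psi <=
    dual_objective p R0 m0 Sigma0 nu Psi l L)%E by exact: weak_duality.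
suff [l [L [l0 L0 hl]]] : exists (lambda : R) (Lambda : 'M[R]_K),
    [/\ 0 <= lambda, psdmx Lambda &
      (dual_objective p R0 m0 Sigma0 nu Psi lambda Lambda
        <= primal_value p R0 m0 Sigma0 nu Psi)%E].
  exists l, L; split => // [|l' L' l'0 L'0].
    by apply/eqP; rewrite eq_le hl weak.
  by apply: le_trans hl _; exact: weak.
(* When the primal value is +oo, weak duality makes every dual value +oo, so zero multipliers are
   already optimal. *)
have [h|h] := eqVneq (primal_value p R0 m0 Sigma0 nu Psi) +oo%E.
  exists 0, 0; split => //; last by rewrite h leey.
  by split=> [|u]; rewrite ?trmx0// mulmx0 mul0mx mxE.
by apply: strong_duality => //; rewrite ltey.
Qed.
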